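(* There is an algorithm that, given a Laurent polynomial $f$ in two variables $x,y$, finds its line polynomial factors. That is, the algorithm determines the primitive directions $\vec v\in\mathbb{Z}^2$ in which $f$ has a line polynomial factor, and finds such factors. Here $f$ is given by finitely many coefficients in a form permitting exact arithmetic, e.g. rational coefficients.
   Context: Write $X^{\vec{u}} = x^{u_1}y^{u_2}$ for $\vec u\in\mathbb{Z}^2$. The support of $f=\sum f_{\vec u}X^{\vec u}$ is $\{\vec u: f_{\vec u}\neq0\}$. A vector $\vec v\in\mathbb{Z}^2$ is primitive if its components are relatively prime. A line polynomial is a Laurent polynomial whose support contains at least two points, all lying on a single line $\vec u+\mathbb{Q}\vec v$; it is then a line polynomial in direction $\vec v$. The polynomial $f$ has a line polynomial factor $\phi$ in direction $\vec v$ if $\phi$ is a line polynomial in direction $\vec v$ and $f=\phi h$ for some Laurent polynomial $h$. *)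

(* Defs.v *)
From HB Require Import structures.
From mathcomp Require Import all_boot all_order all_algebra.
From mathcomp Require Import finmap zify ring lra.

Set Implicit Arguments.
Unset Strict Implicit.
Unset Printing Implicit Defensive.

Import GRing.Theory Num.Theory.
Local Open Scope ring_scope.

(* The class of total recursive functions of several natural arguments, in
   Kleene's presentation with minimization applied to regular functions only.
   Equations are pointwise, so the class is closed under extensional equality
   without an axiom. *)
Inductive recursive : forall k, (k.-tuple nat -> nat) -> Prop :=
| rec_zero : @recursive 0 (fun=> 0%N)
| rec_succ : @recursive 1 (fun v => (tnth v ord0).+1)
| rec_proj k (i : 'I_k) : @recursive k (fun v => tnth v i)
| rec_comp k m (g : m.-tuple nat -> nat) (h : 'I_m -> k.-tuple nat -> nat)
    (f : k.-tuple nat -> nat) :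
    recursive g -> (forall i, recursive (h i)) ->
    (forall v, f v = g [tuple h i v | i < m]) ->
    recursive f
| rec_prim k (g : k.-tuple nat -> nat) (h : k.+2.-tuple nat -> nat)
    (f : k.+1.-tuple nat -> nat) :
    recursive g -> recursive h ->
    (forall v : k.-tuple nat, f [tuple of 0%N :: v] = g v) ->
    (forall n (v : k.-tuple nat),
       f [tuple of n.+1 :: v] = h [tuple of [:: n, f [tuple of n :: v] & v]]) ->
    recursive f
| rec_mu k (g : k.+1.-tuple nat -> nat) (f : k.-tuple nat -> nat) :
    recursive g ->
    (forall v : k.-tuple nat, g [tuple of f v :: v] = 0%N) ->
    (forall (v : k.-tuple nat) j, (j < f v)%N -> g [tuple of j :: v] <> 0%N) ->
    recursive f.

Definition recursive1 (f : nat -> nat) : Prop :=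
  recursive (fun v : 1.-tuple nat => f (tnth v ord0)).

Definition recursive2 (f : nat -> nat -> nat) : Prop :=
  recursive (fun v : 2.-tuple nat => f (tnth v ord0) (tnth v ord_max)).

(* Exact arithmetic in K: every element has at least one name in nat, and on
   names the field operations and the equality test are recursive. *)
Record exact_arithmetic (K : fieldType) (nu : nat -> K) : Prop :=
  ExactArithmetic {
    exact_surj : forall a : K, exists n, nu n = a;
    exact_add : exists2 add : nat -> nat -> nat, recursive2 add &
      forall m n, nu (add m n) = nu m + nu n;
    exact_opp : exists2 opp : nat -> nat, recursive1 opp &
      forall n, nu (opp n) = - nu n;
    exact_mul : exists2 mul : nat -> nat -> nat, recursive2 mul &
      forall m n, nu (mul m n) = nu m * nu n;
    exact_inv : exists2 inv : nat -> nat, recursive1 inv &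
      forall n, nu (inv n) = (nu n)^-1;
    exact_eq : recursive2 (fun m n => nat_of_bool (nu m == nu n))
  }.

(* f u is the coefficient of x ^ u.1 * y ^ u.2, and finsupp f the support. *)
Notation laurent K := {fsfun (int * int)%type -> K with 0}.

Section LinePolynomials.
Variable K : fieldType.
Implicit Types (f g h phi psi : laurent K) (u v w : int * int).

Definition laurent_mul f g : laurent K :=
  [fsfun w in [fset (u + u')%R | u in finsupp f, u' in finsupp g]%fset =>
     \sum_(u <- finsupp f) f u * g (w - u) | 0].

Lemma laurent_mulE f g w :
  laurent_mul f g w = \sum_(u <- finsupp f) f u * g (w - u).
Proof.
rewrite /laurent_mul fsfunE; case: ifP => // /negP w_out.
rewrite big_seq big1 // => u uf.
have [wug|wug] := boolP (w - u \in finsupp g); last first.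
  by rewrite [g _]fsfun_dflt // mulr0.
case: w_out; apply/imfset2P; exists u => //; exists (w - u) => //.
by rewrite addrC subrK.
Qed.

Definition primitive v : bool := coprimez v.1 v.2.

Definition on_line u v w : Prop :=
  exists q : rat, w.1%:~R = u.1%:~R + q * v.1%:~R /\
                  w.2%:~R = u.2%:~R + q * v.2%:~R.

Definition line_poly v phi : Prop :=
  (1 < #|` finsupp phi|)%N /\
  exists u, forall w, w \in finsupp phi -> on_line u v w.

Definition laurent_dvd phi f : Prop := exists h, f = laurent_mul phi h.

Definition line_factor v phi f : Prop := line_poly v phi /\ laurent_dvd phi f.

End LinePolynomials.

(* Codes.  CodeSeq is a bijection between nat and seq nat; missing entries are
   read as 0, so that every natural number is a code. *)

(* 0, -1, 1, -2, 2, ... *)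
Definition int_of_code (n : nat) : int :=
  if odd n then Negz n./2 else Posz n./2.

Definition entry (n i : nat) : nat := nth 0%N (CodeSeq.decode n) i.

Definition vec_of_code (n : nat) : int * int :=
  (int_of_code (entry n 0), int_of_code (entry n 1)).

Section Codes.
Variables (K : fieldType) (nu : nat -> K).

(* A list of terms, each given by its exponents and a name of its coefficient;
   terms with the same exponents are added up. *)
Definition laurent_of_code (n : nat) : laurent K :=
  [fsfun w in [fset vec_of_code t | t in CodeSeq.decode n]%fset =>
     \sum_(t <- CodeSeq.decode n | vec_of_code t == w) nu (entry t 2) | 0].

(* None stands for "every line polynomial in every primitive direction is a
   factor", which is the case of the zero polynomial. *)
Definition answer_of_code (n : nat) : option (seq ((int * int) * laurent K)) :=
  if n is m.+1 then
    Some [seq (vec_of_code e, laurent_of_code (entry e 2)) | e <- CodeSeq.decode m]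
  else None.

(* Monomial multiples and line polynomial divisors of a factor are factors too,
   so there may be infinitely many.  A finite answer gives, for each direction,
   a factor that is divisible by all line polynomial factors in it. *)
Definition correct_answer (f : laurent K)
    (a : option (seq ((int * int) * laurent K))) : Prop :=
  match a with
  | None => forall v phi, primitive v -> line_poly v phi -> line_factor v phi f
  | Some l =>
      (forall v, v \in [seq e.1 | e <- l] <->
         primitive v /\ exists phi, line_factor v phi f) /\
      (forall v phi, (v, phi) \in l ->
         line_factor v phi f /\
         forall psi, line_factor v psi f -> laurent_dvd psi phi)
  end.

Definition code_of_int (z : int) : nat :=
  match z with Posz n => n.*2 | Negz n => n.*2.+1 end.

Lemma code_of_intK : cancel code_of_int int_of_code.
Proof.
by case=> n; rewrite /int_of_code /= odd_double /= ?doubleK // uphalf_double.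
Qed.

Lemma laurent_of_code_surj :
  (forall a : K, exists n, nu n = a) ->
  forall f : laurent K, exists n, laurent_of_code n = f.
Proof.
move=> nu_surj f.
have [nm nmE] : exists nm : int * int -> nat,
    forall u, u \in finsupp f -> nu (nm u) = f u.
  elim/finSet_rect: (finsupp f) => S IH.
  have [->|[u uS]] := fset_0Vmem S; first by exists (fun=> 0%N) => u; rewrite in_fset0.
  have [nm nmE] := IH _ (fproperD1 uS).
  have [n nE] := nu_surj (f u).
  exists (fun w => if w == u then n else nm w) => w wS.
  by case: eqVneq => [->//|wu]; apply: nmE; rewrite !inE wu.
pose t u := CodeSeq.code [:: code_of_int u.1; code_of_int u.2; nm u].
have tE u : vec_of_code (t u) = u.
  by rewrite /vec_of_code /entry CodeSeq.codeK /= !code_of_intK; case: u.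
exists (CodeSeq.code [seq t u | u <- finsupp f]).
apply/fsfunP => w; rewrite fsfunE CodeSeq.codeK.
have -> : (w \in [fset vec_of_code e | e in [seq t u | u <- finsupp f]]%fset)
    = (w \in finsupp f).
  apply/imfsetP/idP => [[e /= /mapP[u uf ->] ->]|wf]; first by rewrite tE.
  by exists (t w); rewrite ?tE //= map_f.
case: finsuppP => // wf.
rewrite big_map (eq_bigl (pred1 w)) => [|u]; last by rewrite tE.
rewrite -big_filter filter_pred1_uniq ?fset_uniq // big_seq1.
by rewrite /entry CodeSeq.codeK /= nmE.
Qed.

End Codes.

(* The rational numbers admit exact arithmetic in the sense above. *)

Local Open Scope nat_scope.

Lemma recursive_ext k (f g : k.-tuple nat -> nat) :
  recursive f -> f =1 g -> recursive g.
Proof.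
move=> rf fg; apply: (rec_comp (h := fun i v => tnth v i) rf) => [i|v].
  exact: rec_proj.
by rewrite -fg; congr f; apply: eq_from_tnth => i; rewrite tnth_mktuple.
Qed.

Lemma rec_app1 k p (f : k.-tuple nat -> nat) :
  recursive1 p -> recursive f -> recursive (fun v => p (f v)).
Proof.
move=> rp rf; apply: (rec_comp (h := fun _ => f) rp) => // v.
by rewrite tnth_mktuple.
Qed.

Lemma rec_app2 k p (f g : k.-tuple nat -> nat) :
  recursive2 p -> recursive f -> recursive g ->
  recursive (fun v => p (f v) (g v)).
Proof.
move=> rp rf rg.
apply: (rec_comp (h := fun i : 'I_2 => if i == ord0 then f else g) rp).
  by move=> i; case: eqP.
by move=> v; rewrite !tnth_mktuple.
Qed.

Lemma rec_const k n : recursive (fun _ : k.-tuple nat => n).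
Proof.
elim: n => [|n IH]; last exact: (rec_app1 rec_succ IH).
by apply: (rec_comp (h := fun i : 'I_0 => fun=> 0) rec_zero) => // -[].
Qed.

Lemma rec_prim2 (p : nat -> nat -> nat) g h :
  recursive1 g ->
  recursive (fun v : 3.-tuple nat => h (tnth v (inord 0)) (tnth v (inord 1)) (tnth v (inord 2))) ->
  (forall n, p 0 n = g n) -> (forall m n, p m.+1 n = h m (p m n) n) ->
  recursive2 p.
Proof.
move=> rg rh p0 pS; apply: (rec_prim rg rh) => [v|m v].
  by rewrite (tnth_nth 0) [in RHS](tnth_nth 0) (tnth_nth 0) /= p0.
by rewrite !(tnth_nth 0) !inordK //= pS.
Qed.

Lemma rec_prim1 (p : nat -> nat) h :
  recursive2 h -> (forall m, p m.+1 = h m (p m)) -> recursive1 p.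
Proof.
move=> rh pS; apply: (rec_prim (rec_const 0 (p 0)) rh) => [v|m v].
  by rewrite !(tnth_nth 0).
by rewrite !(tnth_nth 0) /= pS.
Qed.

Lemma rec_swap p : recursive2 p -> recursive2 (fun m n => p n m).
Proof. by move=> rp; apply: (rec_app2 rp); apply: rec_proj. Qed.

Lemma rec_add : recursive2 addn.
Proof.
apply: (@rec_prim2 _ id (fun _ r _ => r.+1)) => //; first exact: rec_proj.
by apply: (rec_app1 rec_succ); apply: rec_proj.
Qed.

Lemma rec_pred : recursive1 predn.
Proof. by apply: (@rec_prim1 _ (fun m _ => m)) => //; exact: rec_proj. Qed.

Lemma rec_sub : recursive2 subn.
Proof.
apply: rec_swap; apply: (@rec_prim2 _ id (fun _ r _ => r.-1)) => //.
- exact: rec_proj.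
- by apply: (rec_app1 rec_pred); apply: rec_proj.
- exact: subn0.
- by move=> m n; exact: subnS.
Qed.

Lemma rec_mul : recursive2 muln.
Proof.
apply: (@rec_prim2 _ (fun=> 0) (fun _ r n => n + r)) => //.
- exact: rec_const.
- by apply: (rec_app2 rec_add); apply: rec_proj.
Qed.

Lemma rec_exp : recursive2 expn.
Proof.
apply: rec_swap; apply: (@rec_prim2 _ (fun=> 1) (fun _ r n => n * r)) => //.
- exact: rec_const.
- by apply: (rec_app2 rec_mul); apply: rec_proj.
- by move=> m n; exact: expnS.
Qed.

Lemma rec_eq : recursive2 (fun m n => (m == n) : nat).
Proof.
apply: (@recursive_ext _ (fun v : 2.-tuple nat => 1 -
  ((tnth v ord0 - tnth v ord_max) + (tnth v ord_max - tnth v ord0)))).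
  apply: (rec_app2 rec_sub); first exact: rec_const.
  by apply: (rec_app2 rec_add); apply: (rec_app2 rec_sub); apply: rec_proj.
by move=> v /=; case: eqVneq; lia.
Qed.

Lemma rec_mod : recursive2 modn.
Proof.
apply: (@rec_prim2 _ (fun=> 0) (fun _ r d => r.+1 * (1 - (r.+1 == d)))).
- exact: rec_const.
- apply: (rec_app2 rec_mul); first by apply: (rec_app1 rec_succ); apply: rec_proj.
  apply: (rec_app2 rec_sub); first exact: rec_const.
  apply: (rec_app2 rec_eq); last exact: rec_proj.
  by apply: (rec_app1 rec_succ); apply: rec_proj.
- by move=> d; rewrite mod0n.
- move=> m [|d]; first by rewrite !modn0 muln1.
  rewrite -addn1 -modnDml addn1; set r := m %% d.+1.
  have: r < d.+1 by rewrite ltn_mod.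
  rewrite eqSS leq_eqVlt eqSS => /orP[/eqP ->|rd]; first by rewrite eqxx modnn muln0.
  by rewrite modn_small // (ltn_eqF (rd : r < d)) muln1.
Qed.

Lemma rec_logn p : prime p -> recursive1 (logn p).
Proof.
move=> pp; have p1 := prime_gt1 pp.
pose g j n := (0 < n) * (n %% p ^ j.+1 == 0).
have rg : recursive2 g.
  apply: (rec_app2 rec_mul).
    apply: (@recursive_ext _ (fun v : 2.-tuple nat => 1 - (tnth v ord_max == 0))).
      apply: (rec_app2 rec_sub); first exact: rec_const.
      by apply: (rec_app2 rec_eq); [exact: rec_proj | exact: rec_const].
    by move=> v; rewrite -[LHS]/(1 - (tnth v ord_max == 0)); case: (tnth v _).
  apply: (rec_app2 rec_eq); last exact: rec_const.
  apply: (rec_app2 rec_mod); first exact: rec_proj.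
  apply: (rec_app2 rec_exp); first exact: rec_const.
  by apply: (rec_app1 rec_succ); apply: rec_proj.
apply: (rec_mu rg) => [v|v j]; rewrite !(tnth_nth 0) /= /g;
  move: (nth 0 v 0) => [|n]; rewrite ?logn0 // -[nat_of_bool (0 < n.+1)]/1 mul1n.
  by rewrite -/(dvdn _ _) pfactor_dvdn // ltnn.
by rewrite -/(dvdn _ _) pfactor_dvdn // => ->.
Qed.

(* Fractions (a - b) / (c + 1), with a, b, c the exponents of 2, 3, 5 in n. *)
Definition q3 (a b c : nat) : nat := 2 ^ a * 3 ^ b * 5 ^ c.
Definition rat_of_nat (n : nat) : rat :=
  (((logn 2 n)%:R - (logn 3 n)%:R) / (logn 5 n).+1%:R)%R.

Lemma q3E a b c : rat_of_nat (q3 a b c) = ((a%:R - b%:R) / c.+1%:R)%R.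
Proof.
rewrite /rat_of_nat /q3 !(lognM, lognX, muln_gt0, expn_gt0) //.
by rewrite !logn_prime // !(muln1, muln0, addn0, add0n).
Qed.

Lemma rec_q3 k (a b c : k.-tuple nat -> nat) :
  recursive a -> recursive b -> recursive c ->
  recursive (fun v => q3 (a v) (b v) (c v)).
Proof.
move=> ra rb rc; do 2?apply: (rec_app2 rec_mul);
 by apply: (rec_app2 rec_exp) => //; exact: rec_const.
Qed.

Ltac prove_recursive := repeat first
  [ exact: rec_const | exact: rec_proj | apply: rec_q3
  | apply: (rec_app2 rec_add) | apply: (rec_app2 rec_sub) | apply: (rec_app2 rec_mul)
  | apply: (rec_app2 rec_eq)
  | apply: (rec_app1 (rec_logn (isT : prime 2)))
  | apply: (rec_app1 (rec_logn (isT : prime 3)))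
  | apply: (rec_app1 (rec_logn (isT : prime 5)))
  | apply: (rec_app1 rec_succ) ].

Lemma rat_exact : exact_arithmetic rat_of_nat.
Proof.
split.
- move=> r; have -> : r = ((numq r)%:~R / (denq r)%:~R)%R by rewrite divq_num_den.
  have := denq_gt0 r; case: (denq r) => // -[|d] // _.
  case: (numq r) => n.
    by exists (q3 n 0 d); rewrite q3E subr0.
  by exists (q3 0 n.+1 d); rewrite q3E sub0r NegzE mulrNz.
- exists (fun m n => q3 (logn 2 m * (logn 5 n).+1 + logn 2 n * (logn 5 m).+1)
     (logn 3 m * (logn 5 n).+1 + logn 3 n * (logn 5 m).+1)
     ((logn 5 m).+1 * (logn 5 n).+1 - 1)); first by prove_recursive.
  move=> m n; rewrite q3E /rat_of_nat subn1 prednK // !natrD !natrM; field.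
  by rewrite !nat1r !pnatr_eq0.
- exists (fun n => q3 (logn 3 n) (logn 2 n) (logn 5 n)); first by prove_recursive.
  by move=> n; rewrite q3E /rat_of_nat -mulNr opprB.
- exists (fun m n => q3 (logn 2 m * logn 2 n + logn 3 m * logn 3 n)
     (logn 2 m * logn 3 n + logn 3 m * logn 2 n)
     ((logn 5 m).+1 * (logn 5 n).+1 - 1)); first by prove_recursive.
  move=> m n; rewrite q3E /rat_of_nat subn1 prednK // !natrD !natrM; field.
  by rewrite !nat1r !pnatr_eq0.
- exists (fun n => q3 ((logn 5 n).+1 * (1 - (logn 2 n - logn 3 n == 0)))
     ((logn 5 n).+1 * (1 - (logn 3 n - logn 2 n == 0)))
     ((logn 2 n - logn 3 n) + (logn 3 n - logn 2 n) - 1)); first by prove_recursive.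
  move=> n; rewrite q3E /rat_of_nat subn1 invf_div.
  case: (ltngtP (logn 2 n) (logn 3 n)) => [lt|lt|->].
  + have d0 : 0 < logn 3 n - logn 2 n by rewrite subn_gt0.
    rewrite (eqP (ltnW lt)) add0n prednK // eqxx (gtn_eqF d0) subnn muln0 subn0 muln1 sub0r.
    by rewrite natrB 1?ltnW // -(opprB (logn 3 n)%:R%R) invrN mulrN mulNr.
  + have d0 : 0 < logn 2 n - logn 3 n by rewrite subn_gt0.
    rewrite (eqP (ltnW lt)) addn0 prednK // eqxx (gtn_eqF d0) subnn muln0 subn0 muln1 subr0.
    by rewrite natrB 1?ltnW.
  + by rewrite /= subnn !muln0 !subrr mul0r invr0 mulr0.
- apply: (@recursive_ext _ (fun v : 2.-tuple nat =>
    let m := tnth v ord0 in let n := tnth v ord_max in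
    logn 2 m * (logn 5 n).+1 + logn 3 n * (logn 5 m).+1 ==
    logn 2 n * (logn 5 m).+1 + logn 3 m * (logn 5 n).+1)); first by prove_recursive.
  move=> v /=; move: (tnth v _) (tnth v _) => m n; congr nat_of_bool.
  rewrite /rat_of_nat eqr_div ?pnatr_eq0 // -(eqr_nat rat) !natrD !natrM.
  by apply/eqP/eqP => E; lra.
Qed.

(* Main.v *)
Require Import Defs.
From mathcomp Require Import all_boot all_order all_algebra.
From mathcomp Require Import finmap zify ring lra.

(* Fix a primitive direction v.  Write f as a sum of its components on the
   lines parallel to v; up to monomials, these are polynomials in t = X^v.  A
   line polynomial in direction v divides f if and only if it divides all the
   components, that is, if and only if it divides their greatest common divisor
   phi in K[t, 1/t].  The following data (phi, h, a) certify that phi is this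
   greatest common divisor, up to a unit: the support of phi lies on Z v,
   f = phi h, and a f agrees with phi on Z v (the coefficients of a f on Z v are
   a combination of the components, and every combination arises so).  Euclid's
   algorithm shows that certificates exist, and whether given data form one is
   decidable, so that unbounded search finds one for each v.  There is a line
   factor in direction v if and only if phi has at least two terms.  A nonzero
   multiple of a line polynomial in direction v has two terms on some line
   parallel to v, so only finitely many directions have to be tried. *)

Set Implicit Arguments.
Unset Strict Implicit.
Unset Printing Implicit Defensive.

Import Order.TTheory GRing.Theory Num.Theory.

(** * Recursive functions on environments *)

(* Environments have arbitrary length and missing variables read as 0, so that
   binders can be handled by pushing a value, without any arity bookkeeping. *)
Definition crec (F : seq nat -> nat) : Prop :=
  forall k, recursive (fun v : k.-tuple nat => F v).

Definition crec_pred (P : seq nat -> bool) : Prop := crec (fun e => P e).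

Section EnvironmentFunctions.
Implicit Types F G X Y N Z : seq nat -> nat.
Implicit Types P Q : seq nat -> bool.

Lemma crec_ext F G : crec F -> F =1 G -> crec G.
Proof. by move=> cF FG k; apply: recursive_ext (cF k) _ => v; exact: FG. Qed.

Lemma crec_const n : crec (fun=> n).
Proof. by move=> k; exact: rec_const. Qed.

Lemma crec_nth i : crec (fun e => nth 0 e i).
Proof.
move=> k; case: (ltnP i k) => [ik|ki].
  apply: recursive_ext (rec_proj (Ordinal ik)) _ => v.
  by rewrite (tnth_nth 0).
by apply: recursive_ext (rec_const k 0) _ => v; rewrite nth_default ?size_tuple.
Qed.

Lemma crec_comp F (Xs : seq (seq nat -> nat)) :
  crec F -> (forall i, crec (nth (fun=> 0) Xs i)) ->
  crec (fun e => F [seq X e | X <- Xs]).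
Proof.
move=> cF cX k.
apply: (rec_comp (h := fun (i : 'I_(size Xs)) (v : k.-tuple nat) =>
  nth (fun=> 0) Xs i v) (cF (size Xs))) => [i|v]; first exact: cX.
congr F; apply: (@eq_from_nth _ 0); first by rewrite size_map size_tuple.
move=> i; rewrite size_map => i_lt; rewrite (nth_map (fun=> 0)) //.
by rewrite -[i]/(nat_of_ord (Ordinal i_lt)) -tnth_nth tnth_mktuple.
Qed.

Lemma crec_comp2 F X Y :
  crec F -> crec X -> crec Y -> crec (fun e => F [:: X e; Y e]).
Proof.
move=> cF cX cY; apply: (crec_comp (Xs := [:: X; Y]) cF).
by move=> [|[|i]] //=; rewrite nth_nil; exact: crec_const.
Qed.

(** Rebinds variables inside loops. With [n] equal to 2 and [X] the variable 0, a loop environment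
    [i :: r :: e] becomes [i :: e], so predicates that ignore the accumulator [r] can be used in
    loop bodies. *)
Lemma crec_push F X n :
  crec F -> crec X -> crec (fun e => F (X e :: drop n e)).
Proof.
move=> cF cX k.
apply: (rec_comp (h := fun (i : 'I_(k - n).+1) (v : k.-tuple nat) =>
  if i == 0 :> nat then X v else nth 0 v (n + i.-1)) (cF _)) => [i|v].
- by case: i => -[|i] Hi; [exact: cX | exact: crec_nth].
set w := mktuple _; congr F.
apply: (@eq_from_nth _ 0); first by rewrite size_tuple /= size_drop size_tuple.
move=> i; rewrite /= size_drop size_tuple => i_lt.
rewrite -(tnth_nth 0 w (Ordinal i_lt)) tnth_mktuple.
by case: i i_lt => //= i _; rewrite nth_drop.
Qed.

Lemma crec_behead F : crec F -> crec (fun e => F (behead e)).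
Proof.
move=> cF k.
apply: (rec_comp (h := fun (i : 'I_k.-1) (v : k.-tuple nat) =>
  nth 0 v i.+1) (cF k.-1)) => [i|v]; first exact: crec_nth.
set w := mktuple _; congr F.
apply: (@eq_from_nth _ 0); first by rewrite size_behead !size_tuple.
move=> i; rewrite size_behead size_tuple nth_behead => i_lt.
by rewrite -(tnth_nth 0 w (Ordinal i_lt)) tnth_mktuple.
Qed.

Lemma crec_behead2 F : crec F -> crec (fun e => F (behead (behead e))).
Proof. by move=> cF; apply: (crec_behead (crec_behead cF)). Qed.

(** The body sees the counter, the accumulator and then [e]. Taking the counter as an extra first
    argument makes the iteration an instance of [rec_prim]; afterwards [N e] is substituted for
    it. *)
Lemma crec_iteri N Z (B : nat -> nat -> seq nat -> nat) :
  crec N -> crec Z ->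
  crec (fun e => B (nth 0 e 0) (nth 0 e 1) (behead (behead e))) ->
  crec (fun e => iteri (N e) (fun i r => B i r e) (Z e)).
Proof.
move=> cN cZ cB k.
pose f (v : k.+1.-tuple nat) :=
  iteri (nth 0 v 0) (fun i r => B i r (behead v)) (Z (behead v)).
have rf : recursive f by apply: (rec_prim (cZ k) (cB k.+2)).
apply: (rec_comp (h := fun (i : 'I_k.+1) (v : k.-tuple nat) =>
  if i == 0 :> nat then N v else nth 0 v i.-1) rf) => [i|v].
  by case: i => -[|i] Hi; [exact: cN | exact: crec_nth].
rewrite /f; set w := mktuple _.
have -> : nth 0 w 0 = N v.
  by rewrite -(tnth_nth 0 w ord0) tnth_mktuple.
suff -> : behead w = v by [].
apply: (@eq_from_nth _ 0); first by rewrite size_behead !size_tuple.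
move=> i; rewrite size_behead size_tuple nth_behead => i_lt.
by rewrite -(tnth_nth 0 w (lift ord0 (Ordinal i_lt))) tnth_mktuple.
Qed.

Lemma crec_app1 p X : recursive1 p -> crec X -> crec (fun e => p (X e)).
Proof. by move=> rp cX k; exact: rec_app1. Qed.

Lemma crec_app2 p X Y :
  recursive2 p -> crec X -> crec Y -> crec (fun e => p (X e) (Y e)).
Proof. by move=> rp cX cY k; exact: (rec_app2 rp). Qed.

Lemma crec_add X Y : crec X -> crec Y -> crec (fun e => X e + Y e).
Proof. exact: (crec_app2 rec_add). Qed.

Lemma crec_sub X Y : crec X -> crec Y -> crec (fun e => X e - Y e).
Proof. exact: (crec_app2 rec_sub). Qed.

Lemma crec_mul X Y : crec X -> crec Y -> crec (fun e => X e * Y e).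
Proof. exact: (crec_app2 rec_mul). Qed.

Lemma crec_exp X Y : crec X -> crec Y -> crec (fun e => X e ^ Y e).
Proof. exact: (crec_app2 rec_exp). Qed.

Lemma crec_mod X Y : crec X -> crec Y -> crec (fun e => X e %% Y e).
Proof. exact: (crec_app2 rec_mod). Qed.

Lemma crec_succ X : crec X -> crec (fun e => (X e).+1).
Proof. exact: (crec_app1 rec_succ). Qed.

Lemma crec_double X : crec X -> crec (fun e => (X e).*2).
Proof.
by move=> cX; apply: crec_ext (crec_add cX cX) _ => e; rewrite addnn.
Qed.

Lemma crec_eqn X Y : crec X -> crec Y -> crec_pred (fun e => X e == Y e).
Proof. exact: (crec_app2 rec_eq). Qed.

Lemma crec_negb P : crec_pred P -> crec_pred (fun e => ~~ P e).
Proof.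
move=> cP; apply: crec_ext (crec_sub (crec_const 1) cP) _ => e.
by rewrite /=; case: (P e).
Qed.

Lemma crec_andb P Q :
  crec_pred P -> crec_pred Q -> crec_pred (fun e => P e && Q e).
Proof.
by move=> cP cQ; apply: crec_ext (crec_mul cP cQ) _ => e; rewrite mulnb.
Qed.

Lemma crec_orb P Q :
  crec_pred P -> crec_pred Q -> crec_pred (fun e => P e || Q e).
Proof.
move=> cP cQ; apply: crec_ext (crec_negb (crec_andb (crec_negb cP) (crec_negb cQ))) _.
by move=> e; rewrite -negb_or negbK.
Qed.

Lemma crec_if P X Y : crec_pred P -> crec X -> crec Y ->
  crec (fun e => if P e then X e else Y e).
Proof.
move=> cP cX cY.
apply: crec_ext (crec_add (crec_mul cP cX) (crec_mul (crec_negb cP) cY)) _ => e.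
by case: (P e); rewrite /= !(mul1n, mul0n, addn0).
Qed.

Lemma crec_all_iota N (P : nat -> seq nat -> bool) :
  crec N -> crec_pred (fun e => P (nth 0 e 0) (behead e)) ->
  crec_pred (fun e => all (P^~ e) (iota 0 (N e))).
Proof.
move=> cN cP; have cP' := crec_push 2 cP (crec_nth 0).
apply: crec_ext (crec_iteri (B := fun i r e => r * P i e) cN (crec_const 1) _) _.
  apply: crec_ext (crec_mul (crec_nth 1) cP') _ => e /=.
  by rewrite -!drop1 drop_drop.
move=> e; elim: (N e) => [|n IHn]; first by [].
by rewrite -[in RHS]addn1 iotaD all_cat /= andbT IHn mulnb.
Qed.

(** Existence of a witness in every environment makes the minimization regular. The least witness is
    chosen because [rec_mu] asks for the first zero. *)
Lemma crec_search (P : nat -> seq nat -> bool) :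
  crec_pred (fun e => P (nth 0 e 0) (behead e)) ->
  (forall e, exists m, P m e) ->
  exists2 M, crec M & forall e, P (M e) e.
Proof.
move=> cP exP; exists (fun e => ex_minn (exP e)); last by move=> e; case: ex_minnP.
move=> k; apply: (rec_mu (crec_negb cP k.+1)) => [v|v j] /=.
  by case: ex_minnP => m ->.
case: ex_minnP => m _ minP jm.
by case: (boolP (P j v)) => [/minP|//]; rewrite leqNgt jm.
Qed.

(** The code of [x :: s] is [2 ^ x] times an odd number, so the head is a 2-adic valuation. The code
    0 is that of the empty list. *)
Lemma code_decode_cons n : n != 0 ->
  CodeSeq.decode n =
    logn 2 n :: CodeSeq.decode (CodeSeq.code (behead (CodeSeq.decode n))).
Proof.
rewrite CodeSeq.codeK; case E : (CodeSeq.decode n) => [|x s].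
  by rewrite -[n]CodeSeq.decodeK E.
move=> _; congr (_ :: _); rewrite -[n]CodeSeq.decodeK E /=.
rewrite lognM ?expn_gt0 // pfactorK // lognE /=.
by rewrite dvdn2 /= odd_double addn0.
Qed.

(** The odd part of a nonzero code is [m.*2.+1] with [m] the code of the tail; this [m] is found by
    search. *)
Lemma crec_code_behead X :
  crec X -> crec (fun e => CodeSeq.code (behead (CodeSeq.decode (X e)))).
Proof.
move=> cX.
have [|e|T cT PT] := @crec_search (fun m e =>
    (2 ^ logn 2 (X e) * m.*2.+1 == X e) || (X e == 0) && (m == 0)).
- have cX' := crec_behead cX.
  apply: crec_orb; last first.
    by apply: crec_andb; apply: crec_eqn (crec_const _) => //; exact: crec_nth.
  apply: crec_eqn => //; apply: crec_mul.
    by apply: crec_exp (crec_const 2) _; exact: crec_app1 (rec_logn (isT : prime 2)) cX'.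
  exact/crec_succ/crec_double/crec_nth.
- exists (CodeSeq.code (behead (CodeSeq.decode (X e)))).
  have [-> //|X0] := eqVneq (X e) 0.
  apply/orP; left; apply/eqP; rewrite -[RHS]CodeSeq.decodeK [in RHS]code_decode_cons //=.
  by rewrite CodeSeq.decodeK.
- apply: crec_ext cT _ => e; have := PT e.
  have [-> /=|X0] := eqVneq (X e) 0; first by move=> /eqP ->.
  rewrite orbF -[X in _ == X]CodeSeq.decodeK [in X in _ == X]code_decode_cons //=.
  rewrite eqn_pmul2l ?expn_gt0 // eqSS => /eqP/double_inj ->.
  by rewrite CodeSeq.decodeK.
Qed.

Lemma crec_code_cons X Y : crec X -> crec Y ->
  crec (fun e => CodeSeq.code (X e :: CodeSeq.decode (Y e))).
Proof.
move=> cX cY.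
have c : crec (fun e => 2 ^ X e * (Y e).*2.+1).
  by apply: crec_mul; [exact: crec_exp (crec_const 2) cX | exact/crec_succ/crec_double].
by apply: crec_ext c _ => e; rewrite /= CodeSeq.decodeK.
Qed.

Lemma size_decode n : size (CodeSeq.decode n) <= n.
Proof.
rewrite -[n in _ <= n]CodeSeq.decodeK.
elim: (CodeSeq.decode n) => //= x s IHs.
by rewrite -[(size s).+1]mul1n leq_mul ?expn_gt0 // ltnS -addnn (leq_trans IHs) ?leq_addr.
Qed.

(** The loop puts each new index in front, whence the reversed range. *)
Lemma crec_code_filter N (P : nat -> seq nat -> bool) (B : nat -> seq nat -> nat) :
  crec N -> crec_pred (fun e => P (nth 0 e 0) (behead e)) ->
  crec (fun e => B (nth 0 e 0) (behead e)) ->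
  crec (fun e => CodeSeq.code [seq B i e | i <- rev (iota 0 (N e)) & P i e]).
Proof.
move=> cN cP cB.
have cP' := crec_push 2 cP (crec_nth 0); have cB' := crec_push 2 cB (crec_nth 0).
apply: crec_ext (crec_iteri (B := fun i r e =>
  if P i e then CodeSeq.code (B i e :: CodeSeq.decode r) else r) cN (crec_const 0) _) _.
  apply: crec_ext (crec_if cP' (crec_code_cons cB' (crec_nth 1)) (crec_nth 1)) _ => e.
  by rewrite /= -!drop1 drop_drop.
move=> e; elim: (N e) => [|n IHn] //.
rewrite -[in RHS]addn1 iotaD rev_cat /= add0n {}IHn.
by case: (P n e); rewrite /= ?CodeSeq.codeK.
Qed.

Lemma crec_drop X N : crec X -> crec N ->
  crec (fun e => CodeSeq.code (drop (N e) (CodeSeq.decode (X e)))).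
Proof.
move=> cX cN.
apply: crec_ext (crec_iteri
  (B := fun i r e => CodeSeq.code (behead (CodeSeq.decode r))) cN cX _) _.
  exact/crec_code_behead/crec_nth.
move=> e /=; elim: (N e) => [|n IHn] /=; first by rewrite drop0 CodeSeq.decodeK.
by rewrite IHn CodeSeq.codeK -drop1 drop_drop.
Qed.

Lemma crec_entry X N : crec X -> crec N -> crec (fun e => entry (X e) (N e)).
Proof.
move=> cX cN.
apply: crec_ext (crec_app1 (rec_logn (isT : prime 2)) (crec_drop cX cN)) _ => e.
rewrite /entry -[X in nth _ _ X]addn0 -nth_drop.
set s := drop _ _; rewrite -[s in RHS]CodeSeq.codeK.
(* An index out of range leaves the empty list, with code 0, and [logn 2 0 = 0] agrees with the
   default entry. *)
have [->|s0] := eqVneq (CodeSeq.code s) 0; first by [].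
by rewrite [in RHS]code_decode_cons.
Qed.

Lemma crec_foldr (B : nat -> nat -> seq nat -> nat) Z X :
  crec X -> crec Z ->
  crec (fun e => B (nth 0 e 0) (nth 0 e 1) (behead (behead e))) ->
  crec (fun e => foldr (fun t r => B t r e) (Z e) (CodeSeq.decode (X e))).
Proof.
move=> cX cZ cB.
(* The fold runs through the suffixes from the shortest to the longest. By [size_decode], [X e]
   rounds suffice; the first ones may see the empty suffix, with code 0, and leave the accumulator
   alone. *)
pose tl j e := CodeSeq.code (drop (X e - j.+1) (CodeSeq.decode (X e))).
pose C j r e := if tl j e == 0 then r else B (entry (tl j e) 0) r e.
have ctl : crec (fun e => tl (nth 0 e 0) (behead (behead e))).
  apply: crec_drop; first exact: crec_behead2.
  by apply: crec_sub; [exact: crec_behead2 | exact/crec_succ/crec_nth].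
apply: crec_ext (crec_iteri (B := C) cX cZ _) _.
  apply: (crec_if (P := fun e => tl (nth 0 e 0) (behead (behead e)) == 0)).
  - exact: crec_eqn ctl (crec_const 0).
  - exact: crec_nth 1.
  - apply: crec_ext (crec_push 1 cB (crec_entry ctl (crec_const 0))) _ => e.
    by rewrite /= drop1 nth_behead.
move=> e.
have H j : j <= X e -> iteri j (fun i r => C i r e) (Z e) =
    foldr (fun t r => B t r e) (Z e) (drop (X e - j) (CodeSeq.decode (X e))).
  elim: j => [|j IHj] jX; first by rewrite subn0 drop_oversize ?size_decode.
  rewrite /= IHj ?(ltnW jX) // {IHj}/C /tl.
  have -> : X e - j = (X e - j.+1).+1 by lia.
  set k := X e - j.+1; rewrite -add1n -drop_drop drop1 /entry CodeSeq.codeK.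
  case: (drop k _) => [|x s] //=.
  by rewrite muln_eq0 expn_eq0.
by have := H (X e) (leqnn _); rewrite subnn drop0.
Qed.

Lemma crec_all_decode X (P : nat -> seq nat -> bool) :
  crec X -> crec_pred (fun e => P (nth 0 e 0) (behead e)) ->
  crec_pred (fun e => all (P^~ e) (CodeSeq.decode (X e))).
Proof.
move=> cX cP; have cP' := crec_push 2 cP (crec_nth 0).
apply: crec_ext (crec_foldr (B := fun t r e => P t e * r) cX (crec_const 1) _) _.
  apply: crec_ext (crec_mul cP' (crec_nth 1)) _ => e /=.
  by rewrite -!drop1 drop_drop.
by move=> e; elim: (CodeSeq.decode _) => [|t s IH] //=; rewrite IH mulnb.
Qed.

End EnvironmentFunctions.

(** * Recursiveness of integer and field arithmetic *)

(** Rounding [X e] down to an even number and adding 1 gives the code of a list with head 0 whose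
    tail has code [(X e)./2]. *)
Lemma crec_half X : crec X -> crec (fun e => (X e)./2).
Proof.
move=> cX.
have c : crec (fun e => (X e - X e %% 2).+1).
  by apply/crec_succ/crec_sub => //; exact: crec_mod (crec_const 2).
apply: crec_ext (crec_code_behead c) _ => e.
rewrite modn2 -[X in (X - _).+1]odd_double_half addKn.
have -> : (X e)./2.*2.+1 = CodeSeq.code (0 :: CodeSeq.decode (X e)./2).
  by rewrite /= mul1n CodeSeq.decodeK.
by rewrite CodeSeq.codeK /= CodeSeq.decodeK.
Qed.

(** Integers as differences of naturals: the ring operations and the equality test then need no case
    distinction on signs. *)
Definition zrec (Z : seq nat -> int) : Prop :=
  exists P N, [/\ crec P, crec N & forall e, Z e = ((P e)%:Z - (N e)%:Z)%R].

Section IntegerValued.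
Implicit Types (X Y : seq nat -> nat) (Z T : seq nat -> int).
Local Open Scope ring_scope.

Lemma zrec_add Z T : zrec Z -> zrec T -> zrec (fun e => Z e + T e).
Proof.
move=> [P [N [cP cN ZE]]] [P' [N' [cP' cN' TE]]].
exists (fun e => P e + P' e)%N, (fun e => N e + N' e)%N.
split; try exact: crec_add; move=> e.
rewrite ZE TE; lia.
Qed.

Lemma zrec_opp Z : zrec Z -> zrec (fun e => - Z e).
Proof.
by move=> [P [N [cP cN ZE]]]; exists N, P; split=> // e; rewrite ZE opprB.
Qed.

Lemma zrec_sub Z T : zrec Z -> zrec T -> zrec (fun e => Z e - T e).
Proof. by move=> cZ cT; apply: zrec_add => //; exact: zrec_opp. Qed.

Lemma zrec_mul Z T : zrec Z -> zrec T -> zrec (fun e => Z e * T e).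
Proof.
move=> [P [N [cP cN ZE]]] [P' [N' [cP' cN' TE]]].
exists (fun e => P e * P' e + N e * N' e)%N, (fun e => P e * N' e + N e * P' e)%N.
split; try (by apply: crec_add; exact: crec_mul); move=> e.
rewrite ZE TE !PoszD !PoszM; ring.
Qed.

Lemma zrec_int_of_code X : crec X -> zrec (fun e => int_of_code (X e)).
Proof.
move=> cX; have cH := crec_half cX.
have c2 : crec_pred (fun e => X e %% 2 == 1)%N.
  by apply: crec_eqn (crec_const 1); exact: crec_mod (crec_const 2).
exists (fun e => if X e %% 2 == 1 then 0 else (X e)./2)%N.
exists (fun e => if X e %% 2 == 1 then (X e)./2.+1 else 0)%N.
split; first exact: crec_if (crec_const 0) cH.
  exact: crec_if (crec_succ cH) (crec_const 0).
move=> e; rewrite /int_of_code modn2 eqb1.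
by case: odd; rewrite ?NegzE ?sub0r ?subr0.
Qed.

Lemma zrec_eq Z T : zrec Z -> zrec T -> crec_pred (fun e => Z e == T e).
Proof.
move=> [P [N [cP cN ZE]]] [P' [N' [cP' cN' TE]]].
apply: crec_ext (crec_eqn (crec_add cP cN') (crec_add cP' cN)) _ => e.
by congr nat_of_bool; rewrite ZE TE; apply/eqP/eqP => ?; lia.
Qed.

Lemma crec_absz Z : zrec Z -> crec (fun e => `|Z e|%N).
Proof.
move=> [P [N [cP cN ZE]]].
apply: crec_ext (crec_add (crec_sub cP cN) (crec_sub cN cP)) _ => e.
rewrite ZE; lia.
Qed.

Lemma zrec_vec1 X : crec X -> zrec (fun e => (vec_of_code (X e)).1).
Proof. by move=> cX; apply/zrec_int_of_code/crec_entry/crec_const. Qed.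

Lemma zrec_vec2 X : crec X -> zrec (fun e => (vec_of_code (X e)).2).
Proof. by move=> cX; apply/zrec_int_of_code/crec_entry/crec_const. Qed.

Lemma crec_coprime X Y :
  crec X -> crec Y -> crec_pred (fun e => coprime (X e) (Y e)).
Proof.
move=> cX cY.
(* Every common divisor [d] in the range must be 1. The range contains the gcd, including the value
   0 it takes when both numbers vanish. *)
pose P d e := [|| X e %% d != 0, Y e %% d != 0 | d == 1]%N.
have cP : crec_pred (fun e => P (nth 0%N e 0) (behead e)).
  have [cX' cY'] := (crec_behead cX, crec_behead cY).
  apply: crec_orb; last apply: crec_orb.
  - by apply/crec_negb/crec_eqn/crec_const; exact: crec_mod (crec_nth 0).
  - by apply/crec_negb/crec_eqn/crec_const; exact: crec_mod (crec_nth 0).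
  - exact: crec_eqn (crec_nth 0) (crec_const 1).
apply: crec_ext (crec_all_iota (crec_succ (crec_add cX cY)) cP) _ => e.
congr nat_of_bool; apply/allP/idP => [H|cop d _].
  have /H : gcdn (X e) (Y e) \in iota 0 (X e + Y e).+1.
    rewrite mem_iota /= add0n ltnS; have [->|X0] := posnP (X e); first by rewrite gcd0n.
    by apply: leq_trans (leq_addr _ _); rewrite dvdn_leq ?dvdn_gcdl.
  by rewrite /P -![(_ %% _ != _)%N]/(~~ (_ %| _)%N) dvdn_gcdl dvdn_gcdr.
rewrite /P -![(_ %% _ != _)%N]/(~~ (_ %| _)%N) orbA -negb_and -dvdn_gcd.
by rewrite (eqP cop) dvdn1 orNb.
Qed.

Lemma crec_primitive X : crec X -> crec_pred (fun e => primitive (vec_of_code (X e))).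
Proof.
by move=> cX; apply: crec_coprime; apply: crec_absz; [exact: zrec_vec1 | exact: zrec_vec2].
Qed.

(** The determinant of [u] and [v]. For fixed nonzero [v] its level sets in [u] are the lines
    parallel to [v]. *)
Definition cross (u v : int * int) : int := u.1 * v.2 - u.2 * v.1.

Lemma crec_cross0 X Y : crec X -> crec Y ->
  crec_pred (fun e => cross (vec_of_code (X e)) (vec_of_code (Y e)) == 0).
Proof.
move=> cX cY; have [X1 X2] := (zrec_vec1 cX, zrec_vec2 cX).
have [Y1 Y2] := (zrec_vec1 cY, zrec_vec2 cY).
apply: crec_ext (zrec_eq (zrec_mul X1 Y2) (zrec_mul X2 Y1)) _ => e.
by rewrite /cross subr_eq0.
Qed.

Lemma crec_vec_eq X Y : crec X -> crec Y ->
  crec_pred (fun e => vec_of_code (X e) == vec_of_code (Y e)).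
Proof.
move=> cX cY; apply: crec_ext (crec_andb (zrec_eq (zrec_vec1 cX) (zrec_vec1 cY))
  (zrec_eq (zrec_vec2 cX) (zrec_vec2 cY))) _ => e.
by rewrite -xpair_eqE.
Qed.

Lemma crec_vec_eq_sub X Y W : crec X -> crec Y -> crec W ->
  crec_pred (fun e =>
    vec_of_code (X e) == vec_of_code (Y e) - vec_of_code (W e)).
Proof.
move=> cX cY cW; apply: crec_ext (crec_andb
  (zrec_eq (zrec_vec1 cX) (zrec_sub (zrec_vec1 cY) (zrec_vec1 cW)))
  (zrec_eq (zrec_vec2 cX) (zrec_sub (zrec_vec2 cY) (zrec_vec2 cW)))) _ => e.
by rewrite -xpair_eqE.
Qed.

End IntegerValued.

Local Open Scope ring_scope.

(** * Functions with values in a field with exact arithmetic *)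

Section FieldValued.
Variables (K : fieldType) (nu : nat -> K) (hnu : exact_arithmetic nu).
Implicit Types (X Y : seq nat -> nat) (F G : seq nat -> K).

(** A field element may have many names, so only some recursive choice of names is asked for. *)
Definition krec F : Prop := exists2 X, crec X & forall e, nu (X e) = F e.

Lemma krec_nu X : crec X -> krec (fun e => nu (X e)).
Proof. by move=> cX; exists X. Qed.

Lemma krec_const a : krec (fun=> a).
Proof.
have [n <-] := exact_surj hnu a.
by exists (fun=> n) => //; exact: crec_const.
Qed.

Lemma krec_mul F G : krec F -> krec G -> krec (fun e => F e * G e).
Proof.
have [mul rmul mulE] := exact_mul hnu; move=> [X cX XE] [Y cY YE].
by exists (fun e => mul (X e) (Y e)) => [|e]; [exact: crec_app2 | rewrite mulE XE YE].
Qed.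

Lemma krec_if (P : seq nat -> bool) F G : crec_pred P -> krec F -> krec G ->
  krec (fun e => if P e then F e else G e).
Proof.
move=> cP [X cX XE] [Y cY YE].
exists (fun e => if P e then X e else Y e) => [|e]; first exact: crec_if.
by case: (P e).
Qed.

Lemma krec_eq F G : krec F -> krec G -> crec_pred (fun e => F e == G e).
Proof.
move=> [X cX XE] [Y cY YE].
apply: crec_ext (crec_app2 (exact_eq hnu) cX cY) _ => e.
by rewrite /= XE YE.
Qed.

Lemma krec_sum X (F : nat -> seq nat -> K) :
  crec X -> krec (fun e => F (nth 0%N e 0) (behead e)) ->
  krec (fun e => \sum_(t <- CodeSeq.decode (X e)) F t e).
Proof.
have [add radd addE] := exact_add hnu; have [z zE] := exact_surj hnu 0.
move=> cX [Y cY YE].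
exists (fun e => foldr (fun t r => add (Y (t :: e)) r) z (CodeSeq.decode (X e))).
  apply: crec_foldr (crec_const z) _ => //; apply: crec_app2 (crec_nth 1) => //.
  apply: crec_ext (crec_push 2 cY (crec_nth 0)) _ => e.
  by rewrite -!drop1 drop_drop.
move=> e; elim: (CodeSeq.decode _) => [|t s IH] /=; first by rewrite big_nil.
by rewrite big_cons addE IH YE.
Qed.

Definition coef (A : seq ((int * int) * K)) (w : int * int) : K :=
  \sum_(x <- A | x.1 == w) x.2.

(** Convolution of a list of terms with an arbitrary function, that is, multiplication of Laurent
    polynomials without computing any support. *)
Definition act (A : seq ((int * int) * K)) (F : int * int -> K) (w : int * int) : K :=
  \sum_(x <- A) x.2 * F (w - x.1).

Definition terms (n : nat) : seq ((int * int) * K) :=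
  [seq (vec_of_code t, nu (entry t 2)) | t <- CodeSeq.decode n].

Lemma laurent_of_codeE n w : laurent_of_code nu n w = coef (terms n) w.
Proof.
rewrite /coef /terms big_map fsfunE; case: ifP => // /negP w_out.
rewrite big_seq_cond big1 // => t /andP[tn /eqP tw].
by case: w_out; apply/imfsetP; exists t.
Qed.

Lemma krec_coef_sub X Y W : crec X -> crec Y -> crec W ->
  krec (fun e => coef (terms (X e)) (vec_of_code (Y e) - vec_of_code (W e))).
Proof.
move=> cX cY cW.
have [G cG GE] : krec (fun e => \sum_(t <- CodeSeq.decode (X e))
  if vec_of_code t == vec_of_code (Y e) - vec_of_code (W e) then nu (entry t 2) else 0).
  apply: krec_sum => //; apply: krec_if (krec_const 0).
    by apply: crec_vec_eq_sub (crec_nth 0) _ _; exact: crec_behead.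
  exact/krec_nu/crec_entry/crec_const/crec_nth.
by exists G => // e; rewrite GE /coef big_map -big_mkcond.
Qed.

Lemma krec_coef X Y : crec X -> crec Y ->
  krec (fun e => coef (terms (X e)) (vec_of_code (Y e))).
Proof.
move=> cX cY; have [G cG GE] := krec_coef_sub cX cY (crec_const 0).
by exists G => // e; rewrite GE subr0.
Qed.

Lemma krec_act X Y W : crec X -> crec Y -> crec W ->
  krec (fun e => act (terms (X e)) (coef (terms (Y e))) (vec_of_code (W e))).
Proof.
move=> cX cY cW.
have [G cG GE] : krec (fun e => \sum_(t <- CodeSeq.decode (X e))
    nu (entry t 2) * coef (terms (Y e)) (vec_of_code (W e) - vec_of_code t)).
  apply: krec_sum => //; apply: krec_mul.
    exact/krec_nu/crec_entry/crec_const/crec_nth.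
  by apply: krec_coef_sub (crec_nth 0); exact: crec_behead.
by exists G => // e; rewrite GE /act big_map.
Qed.

End FieldValued.

(** * Certificates for line factors *)

Section Convolution.
Variable K : fieldType.
Implicit Types (A B : seq ((int * int) * K)) (F G : int * int -> K).
Implicit Types (f g h phi psi : laurent K) (u v w : int * int).

Lemma coef_neq0 A w : coef A w != 0 -> exists2 x, x \in A & x.1 = w.
Proof.
move=> A0; have [/hasP[x xA /eqP xw]|/hasPn A_w] := boolP (has (fun x => x.1 == w) A).
  by exists x.
by case/eqP: A0; rewrite /coef big_seq_cond big1 // => x /andP[/A_w/negPf->].
Qed.

Lemma act_neq0 A F w : act A F w != 0 -> exists2 x, x \in A & F (w - x.1) != 0.
Proof.
move=> A0; have [/hasP[x xA Fx]|/hasPn A_w] := boolP (has (fun x => F (w - x.1) != 0) A).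
  by exists x.
case/eqP: A0; rewrite /act big_seq big1 // => x /A_w; rewrite negbK => /eqP->.
by rewrite mulr0.
Qed.

Lemma eq_act A F G : F =1 G -> act A F =1 act A G.
Proof. by move=> FG w; apply: eq_bigr => x _; rewrite FG. Qed.

(** Both sides sum [x.2 * y.2] over the pairs with [x.1 + y.1 = w]. *)
Lemma act_coefC A B w : act A (coef B) w = act B (coef A) w.
Proof.
transitivity (\sum_(x <- A) \sum_(y <- B | y.1 == w - x.1) x.2 * y.2).
  by apply: eq_bigr => x _; rewrite /coef mulr_sumr.
rewrite (exchange_big_dep xpredT) //=; apply: eq_bigr => y _.
rewrite /coef mulr_sumr; apply: eq_big => x; last by rewrite mulrC.
by apply/eqP/eqP => ->; rewrite opprB addrC subrK.
Qed.

Definition laurent_terms f : seq ((int * int) * K) :=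
  [seq (u, f u) | u <- finsupp f].

Lemma coef_laurent_terms f : coef (laurent_terms f) =1 f.
Proof.
move=> w; rewrite /coef big_map /=.
have [wf|wf] := boolP (w \in finsupp f); last first.
  rewrite [RHS]fsfun_dflt // big_seq_cond.
  by rewrite big1 // => u /andP[uf /eqP uw]; rewrite -uw uf in wf.
by rewrite -big_filter filter_pred1_uniq ?fset_uniq // big_seq1.
Qed.

(** By [act_coefC] the list [A] can be moved to the side where only its coefficients matter, so any
    list of terms of [f] computes the product. *)
Lemma laurent_mul_act A f g w : coef A =1 f -> laurent_mul f g w = act A g w.
Proof.
move=> Af; transitivity (act (laurent_terms f) g w).
  by rewrite laurent_mulE /act big_map.
have gE := coef_laurent_terms g.
rewrite -!(eq_act _ gE) act_coefC [RHS]act_coefC; apply: eq_act => x.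
by rewrite Af coef_laurent_terms.
Qed.

Lemma laurent_mulC f g : laurent_mul f g = laurent_mul g f.
Proof.
apply/fsfunP => w; have [fE gE] := (coef_laurent_terms f, coef_laurent_terms g).
by rewrite (laurent_mul_act _ _ fE) (laurent_mul_act _ _ gE)
  -(eq_act _ gE) act_coefC (eq_act _ fE).
Qed.

Lemma two_terms phi u v :
  u != v -> phi u != 0 -> phi v != 0 -> (1 < #|` finsupp phi|)%N.
Proof.
move=> uv u0 v0; apply: leq_trans (fsubset_leq_card (_ : [fset u; v]%fset `<=` _)%fset).
  by rewrite cardfs2 uv.
by apply/fsubsetP => x; rewrite !inE => /orP[] /eqP ->; rewrite mem_finsupp.
Qed.

Lemma two_termsP phi : (1 < #|` finsupp phi|)%N ->
  exists u v, [/\ u != v, phi u != 0 & phi v != 0].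
Proof.
have [->|[u uf]] := fset_0Vmem (finsupp phi); first by rewrite cardfs0.
rewrite (cardfsD1 u) uf; have [->|[v]] := fset_0Vmem (finsupp phi `\ u)%fset.
  by rewrite cardfs0.
by rewrite !inE => /andP[vu vf]; exists u, v; split; rewrite -?mem_finsupp // eq_sym.
Qed.

End Convolution.

(** * Coordinates across and along a direction *)

Section Directions.
Implicit Types u v w : int * int.

Lemma crossD u w v : cross (u + w) v = cross u v + cross w v.
Proof. rewrite /cross /=; ring. Qed.

Lemma crossN u v : cross (- u) v = - cross u v.
Proof. rewrite /cross /=; ring. Qed.

Lemma crossB u w v : cross (u - w) v = cross u v - cross w v.
Proof. by rewrite crossD crossN. Qed.

Lemma cross_opp u v : cross u (- v) = - cross u v.
Proof. rewrite /cross /=; ring. Qed.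

(** Orders the points of a line parallel to [v]; with a Bezout vector [b] of [v] in place of [v] it
    counts steps of [v]. *)
Definition dot u v : int := u.1 * v.1 + u.2 * v.2.

Lemma dotD u w v : dot (u + w) v = dot u v + dot w v.
Proof. rewrite /dot /=; ring. Qed.

Lemma dotN u v : dot (- u) v = - dot u v.
Proof. rewrite /dot /=; ring. Qed.

Lemma dotB u w v : dot (u - w) v = dot u v - dot w v.
Proof. by rewrite dotD dotN. Qed.

Lemma dot_opp u v : dot u (- v) = - dot u v.
Proof. rewrite /dot /=; ring. Qed.

Lemma primitive_neq0 v : primitive v -> v != 0.
Proof. by apply: contraL => /eqP->. Qed.

(** The two equations form a linear system in [u - w] whose determinant is [v1 ^+ 2 + v2 ^+ 2]. *)
Lemma cross_dot_inj v u w :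
  v != 0 -> cross u v = cross w v -> dot u v = dot w v -> u = w.
Proof.
case: v u w => [v1 v2] [u1 u2] [w1 w2]; rewrite /cross /dot /= => v0 E1 E2.
have s0 : v1 ^+ 2 + v2 ^+ 2 != 0.
  rewrite paddr_eq0 ?sqr_ge0 // !sqrf_eq0; apply: contra v0.
  by move=> /andP[/eqP-> /eqP->].
have H1 : (u1 - w1) * (v1 ^+ 2 + v2 ^+ 2) = 0.
  have -> : (u1 - w1) * (v1 ^+ 2 + v2 ^+ 2) =
    ((u1 * v2 - u2 * v1) - (w1 * v2 - w2 * v1)) * v2
    + ((u1 * v1 + u2 * v2) - (w1 * v1 + w2 * v2)) * v1 by ring.
  by rewrite E1 E2 !subrr !mul0r addr0.
have H2 : (u2 - w2) * (v1 ^+ 2 + v2 ^+ 2) = 0.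
  have -> : (u2 - w2) * (v1 ^+ 2 + v2 ^+ 2) =
    - ((u1 * v2 - u2 * v1) - (w1 * v2 - w2 * v1)) * v1
    + ((u1 * v1 + u2 * v2) - (w1 * v1 + w2 * v2)) * v2 by ring.
  by rewrite E1 E2 !subrr oppr0 !mul0r addr0.
move/eqP: H1; move/eqP: H2; rewrite !mulf_eq0 (negPf s0) !orbF !subr_eq0.
by move=> /eqP-> /eqP->.
Qed.

Lemma on_line_cross u v w : on_line u v w -> cross w v = cross u v.
Proof.
case=> q [E1 E2]; apply/eqP; rewrite -(eqr_int rat) /cross !(rmorphB, rmorphM) /=.
by rewrite E1 E2; apply/eqP; ring.
Qed.

End Directions.

Lemma seq_max (T : eqType) (m : T -> int) (s : seq T) x : x \in s ->
  exists2 y, y \in s & forall z, z \in s -> m z <= m y.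
Proof.
elim: s x => //= x s IHs x0 _; case: s IHs => [_|y s IHs].
  by exists x => [|z]; rewrite ?mem_head // inE => /eqP->.
have [z zs zmax] := IHs y (mem_head _ _).
have [mxz|mzx] := leP (m x) (m z).
  exists z => [|t]; first by rewrite inE zs orbT.
  by rewrite inE => /predU1P[->//|/zmax].
exists x => [|t]; first by rewrite mem_head.
by rewrite inE => /predU1P[->//|/zmax tz]; exact: le_trans tz (ltW mzx).
Qed.

(** * Multiples of line polynomials, and what certificates prove *)

Section LineFactors.
Variable K : fieldType.
Implicit Types (f g h a phi psi : laurent K) (u v w : int * int).

Lemma line_poly_cross v psi : line_poly v psi ->
  exists c, forall w, psi w != 0 -> cross w v = c.
Proof.
case=> _ [u uP]; exists (cross u v) => w; rewrite -mem_finsupp => /uP.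
exact: on_line_cross.
Qed.

(* The leading terms, with respect to the functional [dot _ v], of psi and of
   one component of g multiply to a term that nothing else can cancel. *)
Lemma laurent_mul_extremal v psi g c u0 w0 : v != 0 ->
  (forall w, psi w != 0 -> cross w v = c) -> psi u0 != 0 -> g w0 != 0 ->
  exists p q, [/\ laurent_mul psi g (p + q) != 0, psi p != 0,
    forall x, psi x != 0 -> dot x v <= dot p v,
    g q != 0 /\ cross q v = cross w0 v &
    forall x, g x != 0 -> cross x v = cross w0 v -> dot x v <= dot q v].
Proof.
move=> v0 psic psiu gw.
have [|p pP pmax] := @seq_max _ (dot^~ v) (finsupp psi) u0; first by rewrite mem_finsupp.
have [|q] := @seq_max _ (dot^~ v) [seq x <- finsupp g | cross x v == cross w0 v] w0.
  by rewrite mem_filter eqxx mem_finsupp.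
rewrite mem_filter mem_finsupp => /andP[/eqP qc gq] qmax.
have {}qmax x : g x != 0 -> cross x v = cross w0 v -> dot x v <= dot q v.
  by move=> gx xc; apply: qmax; rewrite mem_filter xc eqxx mem_finsupp.
rewrite mem_finsupp in pP.
have {}pmax x : psi x != 0 -> dot x v <= dot p v.
  by move=> px; apply: pmax; rewrite mem_finsupp.
exists p, q; split=> //.
rewrite laurent_mulE (bigD1_seq p) ?mem_finsupp ?fset_uniq //=.
rewrite addrAC subrr add0r big_seq_cond big1 ?addr0 ?mulf_neq0 // => x.
rewrite mem_finsupp => /andP[psix xp]; apply/eqP; rewrite mulf_eq0 (negPf psix) /=.
(* If [x] also contributed, then [p + q - x] would lie on the line of [q]. Maximality of [q] then
   gives [dot p v <= dot x v], and maximality of [p] the converse. *)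
apply: contraNT xp => gx; apply/eqP/(cross_dot_inj v0); first by rewrite !psic.
have xc : cross (p + q - x) v = cross w0 v.
  by rewrite crossB crossD (psic _ pP) (psic _ psix) addrAC subrr add0r.
have := qmax _ gx xc; have := pmax _ psix; rewrite dotB dotD; lia.
Qed.

(** The extremal products for [v] and for [- v], on one component of [g], give its highest and
    lowest terms. They differ because two terms of [psi] already have different [dot] values. *)
Lemma line_multiple_two_terms v psi g w : v != 0 -> line_poly v psi ->
  laurent_mul psi g w != 0 ->
  exists u u', [/\ u != u', laurent_mul psi g u != 0,
    laurent_mul psi g u' != 0 & cross u v = cross u' v].
Proof.
move=> v0 line_psi psig; have [c psic] := line_poly_cross line_psi.
have [x [y [xy psix psiy]]] := two_termsP line_psi.1.
have [w0 gw0] : exists w0, g w0 != 0.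
  move: psig; rewrite (laurent_mul_act _ _ (coef_laurent_terms psi)).
  by move=> /act_neq0[z _ gz]; exists (w - z.1).
have [p [q [pq psip pmax [gq qc] qmax]]] := laurent_mul_extremal v0 psic psix gw0.
have nv0 : - v != 0 by rewrite oppr_eq0.
have psic_opp z : psi z != 0 -> cross z (- v) = - c by move=> /psic <-; exact: cross_opp.
have [p' [q' [pq' psip' pmin [gq' qc'] qmin]]] :=
  laurent_mul_extremal nv0 psic_opp psix gw0.
rewrite !cross_opp in qc'; move/oppr_inj: qc' => qc'.
exists (p + q), (p' + q'); split=> //; last first.
  by rewrite !crossD qc qc' (psic _ psip) (psic _ psip').
apply/eqP => /(congr1 (dot^~ v)); rewrite /= !dotD.
have {}pmin z : psi z != 0 -> dot p' v <= dot z v.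
  by move/pmin; rewrite !dot_opp lerN2.
have {qmin} : dot q' v <= dot q v by apply: qmax.
have /eqP : dot x v <> dot y v.
  by move=> E; case/eqP: xy; apply: (cross_dot_inj v0) => //; rewrite !psic.
have := pmax _ psix; have := pmax _ psiy; have := pmin _ psix; have := pmin _ psiy.
by rewrite neq_lt => ? ? ? ? /orP[] ? ?; lia.
Qed.

(* For f != 0, phi is then the greatest common divisor of the components of f
   on the lines parallel to v; the last condition is the Bezout identity. *)
Definition certificate v phi h a f : Prop :=
  [/\ forall w, phi w != 0 -> cross w v = 0,
      f = laurent_mul phi h &
      forall w, cross w v = 0 -> laurent_mul a f w = phi w].

(** With [f = psi g], the polynomial [phi] is the part of [psi (a g)] at level 0 of [cross _ v]. As
    [psi] lives at a single level [c], only the part [G] of [a g] at level [- c] contributes, so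
    [phi = psi G]. *)
Lemma certificate_dvd v phi h a f psi : certificate v phi h a f ->
  line_factor v psi f -> laurent_dvd psi phi.
Proof.
case=> phi0 _ aE [line_psi [g fE]]; have [c psic] := line_poly_cross line_psi.
pose ag := laurent_mul a g.
pose G : laurent K := [fsfun w in finsupp ag => if cross w v == - c then ag w else 0 | 0].
have GE w : G w = if cross w v == - c then ag w else 0.
  by rewrite fsfunE; case: ifP => // /negbT/fsfun_dflt ->; rewrite if_same.
exists G; apply/fsfunP => w; rewrite laurent_mulE.
have GuE u : psi u != 0 -> G (w - u) = if cross w v == 0 then ag (w - u) else 0.
  by move=> /psic uc; rewrite GE crossB uc -[X in _ == X]add0r (inj_eq (addIr _)).
have [w0|w0] := eqVneq (cross w v) 0; last first.
  rewrite big_seq big1 => [|u]; first by apply/eqP; apply: contraNT w0 => /phi0/eqP.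
  by rewrite mem_finsupp => /GuE ->; rewrite (negPf w0) mulr0.
rewrite -aE // fE laurent_mulE; under eq_bigr do rewrite laurent_mulE mulr_sumr.
rewrite exchange_big /=; apply: eq_big_seq => u; rewrite mem_finsupp => /GuE ->.
rewrite w0 eqxx laurent_mulE mulr_sumr; apply: eq_bigr => t _.
by rewrite mulrCA addrAC.
Qed.

Lemma on_line0 v w : primitive v -> cross w v = 0 -> on_line 0 v w.
Proof.
case: v w => v1 v2 [w1 w2] /=; rewrite /on_line /cross /= => pv E.
have [v10|v10] := eqVneq v1 0.
  have v20 : v2%:~R != 0 :> rat.
    by move: pv; rewrite intr_eq0 /primitive /= v10; case: eqP => // ->.
  exists (w2%:~R / v2%:~R); rewrite v10 mulr0 divfK // !add0r.
  move: E; rewrite v10 mulr0 subr0 => /eqP.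
  rewrite mulf_eq0 -(intr_eq0 rat v2) (negPf v20) orbF.
  by move/eqP->.
have v10' : v1%:~R != 0 :> rat by rewrite intr_eq0.
exists (w1%:~R / v1%:~R); rewrite divfK // !add0r; split=> //.
apply: (mulIf v10'); rewrite mulrAC divfK // -!intrM; congr _%:~R.
by apply/esym/eqP; rewrite -subr_eq0 E.
Qed.

Lemma certificate_factor v phi h a f : primitive v ->
  certificate v phi h a f -> (1 < #|` finsupp phi|)%N -> line_factor v phi f.
Proof.
move=> pv [phi0 fE _] card2; split; last by exists h.
by split=> //; exists 0 => w; rewrite mem_finsupp => /phi0; exact: on_line0.
Qed.

(** Conversely, a line factor of [f] divides [phi], which is nonzero since [f] is; nonzero multiples
    of line polynomials have two terms. *)
Lemma certificate_line_factor v phi h a f : primitive v ->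
  certificate v phi h a f -> f <> [fsfun] ->
  (1 < #|` finsupp phi|)%N <-> exists psi, line_factor v psi f.
Proof.
move=> pv cert f0; have [phi0 fE aE] := cert; split=> [card2|[psi psif]].
  by exists phi; exact: certificate_factor cert card2.
have [G phiE] := certificate_dvd cert psif.
have [w phiw] : exists w, phi w != 0.
  have [E|[w]] := fset_0Vmem (finsupp phi); last by rewrite mem_finsupp; exists w.
  case: f0; rewrite fE; apply/fsfunP => w; rewrite laurent_mulE E big_seq_fset0.
  by rewrite fsfun0E.
have [|u [u' [uu' phiu phiu' _]]] :=
    line_multiple_two_terms (w := w) (g := G) (primitive_neq0 pv) psif.1.
  by rewrite -phiE.
by apply: (two_terms uu'); rewrite phiE.
Qed.

End LineFactors.

(** * Existence of certificates *)

Section Existence.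
Variable K : fieldType.
Implicit Types (A B C : seq ((int * int) * K)) (F : int * int -> K).
Implicit Types (p q c : {poly K}).

Lemma act_cat A B F w : act (A ++ B) F w = act A F w + act B F w.
Proof. exact: big_cat. Qed.

Lemma act_shift A F u w : act [seq (x.1 + u, x.2) | x <- A] F w = act A F (w - u).
Proof.
by rewrite /act big_map; apply: eq_bigr => x _ /=; rewrite opprD addrA addrAC.
Qed.

Lemma act_comp A B : exists C, forall F w, act C F w = act A (act B F) w.
Proof.
exists [seq (x.1 + y.1, x.2 * y.2) | x <- A, y <- B] => F w.
rewrite /act big_allpairs_dep; apply: eq_bigr => x _ /=.
by rewrite mulr_sumr; apply: eq_bigr => y _; rewrite mulrA opprD addrA.
Qed.

Variables v b : int * int.
Hypothesis vb : dot v b = 1.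

(** Coordinates in the lattice basis [(b.2, - b.1)], [v]: the point number [k] on the line of level
    [l]. The inverse map is given by [cross _ v] and [dot _ b]. *)
Let pt (l k : int) : int * int := (l * b.2 + k * v.1, k * v.2 - l * b.1).

Lemma cross_pt l k : cross (pt l k) v = l.
Proof. by rewrite -[RHS]mulr1 -vb /cross /dot /=; ring. Qed.

Lemma dot_pt l k : dot (pt l k) b = k.
Proof. by rewrite -[RHS]mulr1 -vb /dot /=; ring. Qed.

Lemma ptK w : pt (cross w v) (dot w b) = w.
Proof.
rewrite /pt /cross /dot; case: w => w1 w2 /=.
by congr (_, _); rewrite -[RHS]mulr1 -vb /dot; ring.
Qed.

Lemma ptB l k k' : pt l (k - k') = pt 0 k + pt l (- k').
Proof. by rewrite /pt; congr (_, _) => /=; ring. Qed.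

Definition poly_coef p (k : int) : K := if k is Posz i then p`_i else 0.

(* The polynomial p in the variable X^v. *)
Definition line_of_poly p w : K := if cross w v == 0 then poly_coef p (dot w b) else 0.

Lemma line_of_polyD p q w : line_of_poly (p + q) w = line_of_poly p w + line_of_poly q w.
Proof.
rewrite /line_of_poly; case: eqP => _; last by rewrite addr0.
by case: (dot w b) => n; rewrite /= ?coefD ?addr0.
Qed.

Lemma line_of_polyZ a p w : line_of_poly (a *: p) w = a * line_of_poly p w.
Proof.
rewrite /line_of_poly; case: eqP => _; last by rewrite mulr0.
by case: (dot w b) => n; rewrite /= ?coefZ ?mulr0.
Qed.

Lemma line_of_poly_mulX p w : line_of_poly (p * 'X) w = line_of_poly p (w - v).
Proof.
have crossvv : cross v v = 0 by rewrite /cross mulrC subrr.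
rewrite /line_of_poly crossB crossvv subr0; case: eqP => // _.
rewrite dotB vb; case: (dot w b) => [[|n]|n] /=; first by rewrite coefMX.
  by rewrite coefMX /= subSS subn0.
by [].
Qed.

(** Horner's scheme: multiplication by the variable is a shift by [v], so the terms of [c] are built
    by repeatedly shifting and adding a constant term at 0. *)
Lemma line_of_poly_act c : exists2 C, all (fun x => cross x.1 v == 0) C &
  forall p w, act C (line_of_poly p) w = line_of_poly (c * p) w.
Proof.
elim/poly_ind: c => [|c a [C lineC CE]].
  exists [::] => // p w; rewrite mul0r -(scale0r 0) line_of_polyZ mul0r.
  exact: big_nil.
exists ((0, a) :: [seq (x.1 + v, x.2) | x <- C]).
  rewrite /= {1}/cross !mul0r subrr eqxx /= all_map; apply: sub_all lineC => x /= /eqP x0.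
  by rewrite crossD x0 /cross mulrC subrr.
move=> p w; rewrite -cat1s act_cat act_shift CE {1}/act big_seq1 subr0 /=.
by rewrite -line_of_poly_mulX -line_of_polyZ -line_of_polyD mulrDl mul_polyC mulrAC addrC.
Qed.

Variable f : laurent K.

Lemma dot_bound : exists m : nat, forall w, f w != 0 -> (`|dot w b| <= m)%N.
Proof.
exists (\sum_(u <- finsupp f) `|dot u b|)%N => w; rewrite -mem_finsupp => wf.
by rewrite (big_rem w) //= leq_addr.
Qed.

(** The part of [f] on the line of level [l], multiplied by the [m]-th power of the variable to make
    the exponents from [- m] to [m] nonnegative. *)
Definition component (m : nat) (l : int) : {poly K} :=
  \poly_(i < m.*2.+1) f (pt l (i%:Z - m%:Z)).

Lemma component_coef m l k : (forall w, f w != 0 -> (`|dot w b| <= m)%N) ->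
  poly_coef (component m l) k = f (pt l (k - m%:Z)).
Proof.
move=> fm; have out : (m < `|(k - m%:Z)|)%N -> f (pt l (k - m%:Z)) = 0.
  by move=> km; apply/eqP; apply: contraTT km => /fm; rewrite dot_pt -leqNgt.
case: k out => n out /=; last by rewrite out //; lia.
by rewrite coef_poly; case: ifP => // nm; rewrite out //; lia.
Qed.

(* p lies in the ideal generated by the components of f. *)
Definition combination p : Prop :=
  exists A, forall w, cross w v = 0 -> act A f w = line_of_poly p w.

Lemma combinationD p q : combination p -> combination q -> combination (p + q).
Proof.
move=> [A AE] [B BE]; exists (A ++ B) => w w0.
by rewrite act_cat AE // BE // line_of_polyD.
Qed.

Lemma combinationM c p : combination p -> combination (c * p).
Proof.
move=> [A AE]; have [C lineC CE] := line_of_poly_act c.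
have [B BE] := act_comp C A; exists B => w w0.
rewrite BE -CE; apply: eq_big_seq => x /(allP lineC)/eqP x0.
by rewrite AE // crossB w0 x0 subr0.
Qed.

Lemma combination_component m l : (forall w, f w != 0 -> (`|dot w b| <= m)%N) ->
  combination (component m l).
Proof.
(* A single monomial moves the line of level [l] to level 0, with the offset [m] of [component]. *)
move=> fm; exists [:: (- pt l (- m%:Z), 1)] => w w0.
rewrite /act big_seq1 mul1r opprK /line_of_poly w0 eqxx component_coef // ptB.
by rewrite -[in pt 0 _]w0 ptK.
Qed.

(** Starting from 0, each level replaces [p] by a Bezout combination of [p] and the new component,
    which is their gcd up to a unit. *)
Lemma exists_gcd_components m (ls : seq int) :
  (forall w, f w != 0 -> (`|dot w b| <= m)%N) ->
  exists2 p, combination p & all (fun l => p %| component m l) ls.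
Proof.
move=> fm; elim: ls => [|l ls [p pJ p_dvd]].
  exists 0 => //; exists [::] => w _; rewrite -(scale0r 0) line_of_polyZ mul0r.
  exact: big_nil.
have [[s t] /= Bez] := Bezoutp p (component m l).
exists (s * p + t * component m l).
  by apply: combinationD; apply: combinationM => //; exact: combination_component.
rewrite /= (eqp_dvdl _ Bez) dvdp_gcdr; apply: sub_all p_dvd => l' /=.
by rewrite (eqp_dvdl _ Bez); apply: dvdp_trans; exact: dvdp_gcdl.
Qed.

(** The quotient of each component by [p] is moved back to its line. A repeated level is skipped,
    lest its component be counted twice. *)
Lemma exists_cofactor m p (ls : seq int) :
  (forall w, f w != 0 -> (`|dot w b| <= m)%N) ->
  all (fun l => p %| component m l) ls ->
  exists H, forall w,
    act H (line_of_poly p) w = if cross w v \in ls then f w else 0.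
Proof.
move=> fm; elim: ls => [_|l ls IH /= /andP[p_dvd_l /IH[H HE]]].
  by exists [::] => w; exact: big_nil.
have [l_ls|l_ls] := boolP (l \in ls).
  exists H => w; rewrite HE inE; case: eqP => // ->.
  by rewrite l_ls.
have /dvdpP[c cE] := p_dvd_l; have [C _ CE] := line_of_poly_act c.
exists (H ++ [seq (x.1 + pt l (- m%:Z), x.2) | x <- C]) => w.
rewrite act_cat act_shift HE CE -cE /line_of_poly crossB cross_pt subr_eq0 inE.
have [wl|_] := eqVneq (cross w v) l; last by rewrite addr0.
by rewrite wl (negPf l_ls) add0r component_coef // dotB dot_pt opprK addrK -wl ptK.
Qed.

Lemma exists_certificate : exists C H A,
  [/\ all (fun x => cross x.1 v == 0) C,
      forall w, act H (coef C) w = f w &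
      forall w, cross w v = 0 -> act A f w = coef C w].
Proof.
have [m fm] := dot_bound.
have [p [A AE] p_dvd] := exists_gcd_components [seq cross u v | u <- finsupp f] fm.
have [H HE] := exists_cofactor fm p_dvd.
have [C lineC CE] := line_of_poly_act p.
have coefC w : coef C w = line_of_poly p w.
  (* [line_of_poly 1] is 1 at the origin and 0 elsewhere, so letting [C] act on it reads off the
     coefficients of [C]. *)
  rewrite -[p]mulr1 -CE /coef /act big_mkcond; apply: eq_bigr => x _.
  rewrite /line_of_poly.
  have [->|xw] := eqVneq x.1 w.
    by rewrite subrr /cross /dot /= !mul0r subrr eqxx /= coef1 mulr1.
  case: eqP => [c0|_]; last by rewrite mulr0.
  case E : (dot _ _) => [[|n]|n] /=; rewrite ?coef1 ?mulr0 //.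
  by case/eqP: xw; apply/esym/eqP; rewrite -subr_eq0 -[_ - _]ptK c0 E /pt !mul0r.
exists C, H, A; split=> // [w|w w0]; last by rewrite AE // coefC.
rewrite (eq_act _ coefC) HE; case: ifPn => // /negP w_out.
apply/esym/eqP; apply: contra_notT w_out => fw.
by apply: map_f; rewrite mem_finsupp.
Qed.

End Existence.

(** * The algorithm *)

Lemma primitive_dot v : primitive v -> exists b, dot v b = 1.
Proof.
move=> /eqP pv; have [x [y E]] := Bezoutz v.1 v.2.
by exists (x, y); rewrite /dot /= mulrC [v.2 * _]mulrC E pv.
Qed.

(** For a Bezout vector [b] of [v], [u] is the multiple of [v] by the nonzero integer [dot u b]. *)
Lemma cross0_multiple v u : primitive v -> cross u v = 0 -> u != 0 ->
  (`|v.1| <= `|u.1|)%N /\ (`|v.2| <= `|u.2|)%N.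
Proof.
move=> /primitive_dot[b vb] u0 un0.
have [u1 u2] : u.1 = dot u b * v.1 /\ u.2 = dot u b * v.2.
  move: u0 vb; rewrite /cross /dot => u0 vb.
  split.
    rewrite -[LHS]mulr1 -vb.
    transitivity ((u.1 * v.2 - u.2 * v.1) * b.2 + (u.1 * b.1 + u.2 * b.2) * v.1).
      by ring.
    by rewrite u0 mul0r add0r.
  rewrite -[LHS]mulr1 -vb.
  transitivity ((u.1 * b.1 + u.2 * b.2) * v.2 - (u.1 * v.2 - u.2 * v.1) * b.1).
    by ring.
  by rewrite u0 mul0r subr0.
have d0 : dot u b != 0.
  apply: contraNneq un0 => d0; rewrite [u]surjective_pairing u1 u2 d0 !mul0r.
  by [].
by rewrite u1 u2 !abszM !leq_pmull ?absz_gt0.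
Qed.

(** Integers of absolute value at most [k] have codes at most [k.*2.+1], and list codes grow with
    the entries. The final successor is there because [iota] excludes its end. *)
Definition vec_bound (k : nat) : nat :=
  (CodeSeq.code [:: k.*2.+1; k.*2.+1])%N.+1.

Lemma vec_of_code_bound k v : (`|v.1| <= k)%N -> (`|v.2| <= k)%N ->
  exists2 i, i \in iota 0 (vec_bound k) & vec_of_code i = v.
Proof.
move=> v1k v2k.
exists (CodeSeq.code [:: code_of_int v.1; code_of_int v.2]); last first.
  by rewrite /vec_of_code /entry CodeSeq.codeK /= !code_of_intK; case: v {v1k v2k}.
have code_le z : (`|z| <= k)%N -> (code_of_int z <= k.*2.+1)%N.
  by case: z => n /= nk; lia.
rewrite mem_iota add0n ltnS /vec_bound /= !muln1.
by rewrite leq_mul ?leq_pexp2l ?code_le // ltnS leq_double leq_pexp2l ?code_le.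
Qed.

Lemma crec_vec_bound X : crec X -> crec (fun e => vec_bound (X e)).
Proof.
move=> cX; have c2 := crec_succ (crec_double cX).
apply: crec_ext (crec_succ (crec_code_cons c2 (crec_code_cons c2 (crec_const 0)))) _ => e.
by rewrite !CodeSeq.codeK.
Qed.

Lemma entry_le n i : (entry n i <= n)%N.
Proof.
rewrite /entry; have [i_lt|i_ge] := ltnP i (size (CodeSeq.decode n)).
  exact/ltnW/(allP (CodeSeq.gtn_decode n))/mem_nth.
by rewrite nth_default.
Qed.

Lemma absz_int_of_code n : (`|int_of_code n| <= n)%N.
Proof. by rewrite /int_of_code; case: ifP => /=; lia. Qed.

Section Algorithm.
Variables (K : fieldType) (nu : nat -> K) (hnu : exact_arithmetic nu).

(** A code bounds its entries, so the code of a polynomial gives a computable box around its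
    support. *)
Lemma terms_bound n x : x \in terms nu n ->
  (`|x.1.1| <= n)%N /\ (`|x.1.2| <= n)%N.
Proof.
case/mapP => t /(allP (CodeSeq.gtn_decode n))/= tn -> /=.
by split; apply: leq_trans (absz_int_of_code _) _; apply: leq_trans (entry_le _ _) (ltnW tn).
Qed.

Lemma terms_surj (A : seq ((int * int) * K)) : exists n, terms nu n = A.
Proof.
suff [s sE] : exists s, [seq (vec_of_code t, nu (entry t 2)) | t <- s] = A.
  by exists (CodeSeq.code s); rewrite /terms CodeSeq.codeK.
elim: A => [|[u a] A [s sE]]; first by exists [::].
have [n nE] := exact_surj hnu a.
exists (CodeSeq.code [:: code_of_int u.1; code_of_int u.2; n] :: s).
by rewrite map_cons sE /vec_of_code /entry CodeSeq.codeK /= !code_of_intK nE; case: u.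
Qed.

(* The three entries of m are codes of phi, h and a.  Both sides of the two
   identities vanish outside the box enumerated by js. *)
Definition check (n i m : nat) : bool :=
  let v := vec_of_code i in
  let js := iota 0 (vec_bound (n + m + (n + m))) in
  ~~ primitive v ||
  [&& all (fun t => cross (vec_of_code t) v == 0) (CodeSeq.decode (entry m 0)),
      all (fun j => act (terms nu (entry m 1)) (coef (terms nu (entry m 0))) (vec_of_code j)
                    == coef (terms nu n) (vec_of_code j)) js &
      all (fun j => (cross (vec_of_code j) v != 0) ||
                    (act (terms nu (entry m 2)) (coef (terms nu n)) (vec_of_code j)
                     == coef (terms nu (entry m 0)) (vec_of_code j))) js].

Lemma crec_check N X M : crec N -> crec X -> crec M ->
  crec_pred (fun e => check (N e) (X e) (M e)).
Proof.
move=> cN cX cM; have [cN' cX' cM'] := And3 (crec_behead cN) (crec_behead cX) (crec_behead cM).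
have cB : crec (fun e => vec_bound (N e + M e + (N e + M e))).
  by apply: crec_vec_bound; do ?apply: crec_add.
have cent j : crec (fun e => entry (M (behead e)) j).
  exact: crec_entry (crec_const j).
apply: crec_orb; first exact/crec_negb/crec_primitive.
apply: crec_andb; last apply: crec_andb.
- apply: (crec_all_decode (P := fun t e => cross _ (vec_of_code (X e)) == 0)).
    exact: crec_entry (crec_const 0).
  exact: crec_cross0 (crec_nth 0) cX'.
- apply: (crec_all_iota (P := fun j e =>
    act (terms nu (entry (M e) 1)) (coef (terms nu (entry (M e) 0))) (vec_of_code j)
      == coef (terms nu (N e)) (vec_of_code j))) => //.
  apply: (krec_eq hnu); first by apply: (krec_act hnu) => //; exact: crec_nth 0.
  by apply: (krec_coef hnu) => //; exact: crec_nth 0.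
- apply: (crec_all_iota (P := fun j e => (cross (vec_of_code j) (vec_of_code (X e)) != 0) ||
    (act (terms nu (entry (M e) 2)) (coef (terms nu (N e))) (vec_of_code j)
      == coef (terms nu (entry (M e) 0)) (vec_of_code j)))) => //.
  apply: crec_orb; first by apply/crec_negb/crec_cross0; [exact: crec_nth 0 | exact: cX'].
  apply: (krec_eq hnu); first by apply: (krec_act hnu) => //; exact: crec_nth 0.
  by apply: (krec_coef hnu) => //; exact: crec_nth 0.
Qed.

(** Makes the unbounded search terminate; in a direction that is not primitive, every [m] passes. *)
Lemma check_total n i : exists m, check n i m.
Proof.
have [pv|npv] := boolP (primitive (vec_of_code i)); last by exists 0%N; rewrite /check npv.
have [b vb] := primitive_dot pv.
have [C [H [A [lineC HE AE]]]] := exists_certificate vb (laurent_of_code nu n).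
have [[c cE] [h hE] [a aE]] := And3 (terms_surj C) (terms_surj H) (terms_surj A).
exists (CodeSeq.code [:: c; h; a]); rewrite /check; move: (iota _ _) => js.
rewrite /entry CodeSeq.codeK /= cE hE aE pv /=; apply/and3P; split.
- by move: lineC; rewrite -cE /terms all_map.
- by apply/allP => j _; rewrite HE laurent_of_codeE.
- apply/allP => j _; rewrite -implybE; apply/implyP => /eqP j0.
  by rewrite -AE // (eq_act _ (laurent_of_codeE nu n)).
Qed.

(** All codes involved are at most [n + m], hence exponents of products are at most twice that in
    absolute value. The finite box therefore decides the identities everywhere. *)
Lemma check_certificate n i m : primitive (vec_of_code i) -> check n i m ->
  certificate (vec_of_code i) (laurent_of_code nu (entry m 0))
    (laurent_of_code nu (entry m 1)) (laurent_of_code nu (entry m 2)) (laurent_of_code nu n).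
Proof.
move=> pv /orP[/negP//|/and3P[/allP line0 /allP fac /allP bez]].
have E := laurent_of_codeE nu.
have bounded_eq (F G : int * int -> K) (P : pred (int * int)) :
    (forall w, F w != 0 -> (`|w.1| <= n + m + (n + m))%N /\ (`|w.2| <= n + m + (n + m))%N) ->
    (forall w, G w != 0 -> (`|w.1| <= n + m + (n + m))%N /\ (`|w.2| <= n + m + (n + m))%N) ->
    (forall j, j \in iota 0 (vec_bound (n + m + (n + m))) ->
      P (vec_of_code j) -> F (vec_of_code j) = G (vec_of_code j)) ->
    forall w, P w -> F w = G w.
  move=> Fb Gb FG w Pw.
  have [F0|/Fb[w1 w2]] := eqVneq (F w) 0.
    have [->|/Gb[w1 w2]] := eqVneq (G w) 0; first by rewrite F0.
    by have [j jB jw] := vec_of_code_bound w1 w2; rewrite -jw; apply: FG; rewrite ?jw.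
  by have [j jB jw] := vec_of_code_bound w1 w2; rewrite -jw; apply: FG; rewrite ?jw.
have coef_bound k w : (k <= n + m)%N -> coef (terms nu k) w != 0 ->
    (`|w.1| <= n + m)%N /\ (`|w.2| <= n + m)%N.
  move=> kb /coef_neq0[x /terms_bound[x1 x2] <-].
  by split; [exact: leq_trans x1 kb | exact: leq_trans x2 kb].
have act_bound k l w : (k <= n + m)%N -> (l <= n + m)%N ->
    act (terms nu k) (coef (terms nu l)) w != 0 ->
    (`|w.1| <= n + m + (n + m))%N /\ (`|w.2| <= n + m + (n + m))%N.
  move=> kb lb /act_neq0[x /terms_bound[x1 x2] /(coef_bound _ _ lb)].
  case: w x x1 x2 => w1 w2 [[x1 x2] a] /=; lia.
have nb : (n <= n + m)%N by lia.
have mb j : (entry m j <= n + m)%N by have := entry_le m j; lia.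
split.
- move=> w; rewrite E => /coef_neq0[_ /mapP[t /line0/eqP t0 ->] <-].
  exact: t0.
- rewrite laurent_mulC; apply/fsfunP => w.
  rewrite (laurent_mul_act _ _ (fun x => esym (E (entry m 1) x))) E (eq_act _ (E (entry m 0))).
  apply/esym; apply: (bounded_eq _ _ predT) => // [w'|w'|j /fac/eqP//].
    exact: act_bound.
  by move=> /(coef_bound _ _ nb); lia.
- move=> w w0; rewrite (laurent_mul_act _ _ (fun x => esym (E (entry m 2) x))) E.
  rewrite (eq_act _ (E n)).
  apply: (bounded_eq _ _ (fun w => cross w (vec_of_code i) == 0)) => // [w'|w'|j /bez|].
  + exact: act_bound.
  + by move=> /(coef_bound _ _ (mb 0)); lia.
  + by move=> H j0; move: H; rewrite j0 /= => /eqP.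
  + exact/eqP.
Qed.

End Algorithm.

(** * Tests on the answer and a bound on the directions *)

Section Answer.
Variables (K : fieldType) (nu : nat -> K) (hnu : exact_arithmetic nu).

(** Terms may cancel, so the coefficients are tested at all listed exponents. *)
Definition is_zero (n : nat) : bool :=
  all (fun t => coef (terms nu n) (vec_of_code t) == 0) (CodeSeq.decode n).

Lemma crec_is_zero X : crec X -> crec_pred (fun e => is_zero (X e)).
Proof.
move=> cX; apply: (crec_all_decode
  (P := fun t e => coef (terms nu (X e)) (vec_of_code t) == 0)) => //.
apply: (krec_eq hnu) (krec_const hnu 0).
by apply: (krec_coef hnu) (crec_nth 0); exact: crec_behead.
Qed.

Lemma is_zeroP n : reflect (laurent_of_code nu n = [fsfun]) (is_zero n).
Proof.
apply: (iffP allP) => [H|E t _]; last by rewrite -laurent_of_codeE E fsfun0E.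
apply/fsfunP => w; rewrite laurent_of_codeE fsfun0E; apply/eqP.
have [//|wn] := eqVneq; have [_ /mapP[t /H/eqP t0 ->] /= tw] := coef_neq0 wn.
by rewrite -tw t0 eqxx in wn.
Qed.

Definition has_two_terms (n : nat) : bool :=
  ~~ all (fun t => all (fun s => [|| vec_of_code t == vec_of_code s,
      coef (terms nu n) (vec_of_code t) == 0 | coef (terms nu n) (vec_of_code s) == 0])
    (CodeSeq.decode n)) (CodeSeq.decode n).

Lemma crec_has_two_terms X : crec X -> crec_pred (fun e => has_two_terms (X e)).
Proof.
move=> cX; have cX1 := crec_behead cX; have cX2 := crec_behead cX1.
apply/crec_negb/(crec_all_decode (P := fun t e => all (fun s =>
   [|| vec_of_code t == vec_of_code s,
      coef (terms nu (X e)) (vec_of_code t) == 0 | coef (terms nu (X e)) (vec_of_code s) == 0])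
    (CodeSeq.decode (X e)))) => //.
apply: (crec_all_decode (P := fun s e =>
   [|| vec_of_code (nth 0%N e 0) == vec_of_code s,
      coef (terms nu (X (behead e))) (vec_of_code (nth 0%N e 0)) == 0
      | coef (terms nu (X (behead e))) (vec_of_code s) == 0])) => //.
have c0 := crec_nth 0; have c1 := crec_behead c0.
apply: crec_orb; [exact: crec_vec_eq c1 c0 | apply: crec_orb].
  by apply: (krec_eq hnu) (krec_const hnu 0); exact: (krec_coef hnu cX2 c1).
by apply: (krec_eq hnu) (krec_const hnu 0); exact: (krec_coef hnu cX2 c0).
Qed.

Lemma has_two_termsE n :
  has_two_terms n = (1 < #|` finsupp (laurent_of_code nu n)|)%N.
Proof.
have E := laurent_of_codeE nu n; apply/idP/idP.
  case/allPn => t tn /allPn[s sn]; rewrite !negb_or => /and3P[ts t0 s0].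
  by apply: (two_terms ts); rewrite E.
move=> /two_termsP[u [w [uw]]]; rewrite !E => u0 w0.
have [_ /mapP[t tn ->] /= tu] := coef_neq0 u0.
have [_ /mapP[s sn ->] /= sw] := coef_neq0 w0.
apply/allPn; exists t => //; apply/allPn; exists s => //.
by rewrite tu sw !negb_or uw u0.
Qed.

(** Some two exponents of the polynomial differ by a nonzero multiple of [v], and each of them is
    bounded by [n]. *)
Lemma line_factor_bound n v psi : primitive v ->
  line_factor v psi (laurent_of_code nu n) -> laurent_of_code nu n <> [fsfun] ->
  (`|v.1| <= n + n)%N /\ (`|v.2| <= n + n)%N.
Proof.
move=> pv [line_psi [g fE]] f0.
have [w fw] : exists w, laurent_of_code nu n w != 0.
  have [E|[w]] := fset_0Vmem (finsupp (laurent_of_code nu n)).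
    case: f0; apply/fsfunP => w; rewrite fsfun0E; apply/eqP.
    by rewrite -memNfinsupp E.
  by rewrite mem_finsupp; exists w.
rewrite fE in fw.
have [u [u' []]] := line_multiple_two_terms (primitive_neq0 pv) line_psi fw.
rewrite -fE !laurent_of_codeE => uu' /coef_neq0[x /terms_bound[x1 x2] xu].
move=> /coef_neq0[x' /terms_bound[x1' x2'] xu'] /eqP.
rewrite -subr_eq0 -crossB => /eqP c0.
have [] := cross0_multiple pv c0; first by rewrite subr_eq0.
by move: x1 x2 x1' x2'; rewrite xu xu' /=; lia.
Qed.

End Answer.

Theorem theorem6 (K : fieldType) (nu : nat -> K) (hnu : exact_arithmetic nu) :
  exists A : nat -> nat, recursive1 A /\
    forall (f : {fsfun (int * int)%type -> K with 0%R}) (n : nat),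
      laurent_of_code nu n = f ->
      correct_answer f (answer_of_code nu (A n)).
Proof.
(* [M] sends [[:: n; i]] to the code of a certificate for the polynomial [n] in the direction
   [i]. *)
have [|e|M cM MP] := @crec_search (fun m e => check nu (nth 0%N e 0) (nth 0%N e 1) m).
- have [c0 c1] := (crec_behead (crec_nth 0), crec_behead (crec_nth 1)).
  exact: (crec_check hnu c0 c1 (crec_nth 0)).
- exact: check_total.
pose phi n i := entry (M [:: n; i]) 0.
pose good n i := primitive (vec_of_code i) && has_two_terms nu (phi n i).
pose item n i := CodeSeq.code [:: entry i 0; entry i 1; phi n i].
(* The range comes from [line_factor_bound]. A direction with several codes may be listed
   repeatedly, which [correct_answer] allows. *)
pose js n := [seq i <- rev (iota 0 (vec_bound (n + n))) | good n i].
(* The value 0 encodes [None], the answer for the zero polynomial; the successor encodes [Some]. *)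
pose A n := if is_zero nu n then 0%N else (CodeSeq.code [seq item n i | i <- js n]).+1.
have cphi X Y : crec X -> crec Y -> crec (fun e => phi (X e) (Y e)).
  by move=> cX cY; apply: crec_entry (crec_const 0); exact: crec_comp2.
have cA : crec (fun e => A (nth 0%N e 0)).
  have c0 := crec_nth 0; have c1 := crec_behead c0.
  apply: crec_if; [exact: (crec_is_zero hnu) | exact: crec_const | apply: crec_succ].
  apply: (crec_code_filter (P := fun i e => good (nth 0%N e 0) i)
    (B := fun i e => item (nth 0%N e 0) i)).
  - exact/crec_vec_bound/crec_add.
  - apply: crec_andb; first exact: crec_primitive.
    exact/(crec_has_two_terms hnu)/cphi.
  - have cent j : crec (fun e => entry (nth 0%N e 0) j) by exact: crec_entry (crec_const j).
    apply: crec_ext (crec_code_cons (cent 0%N) (crec_code_cons (cent 1%N)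
      (crec_code_cons (cphi _ _ c1 c0) (crec_const 0)))) _ => e.
    by rewrite !CodeSeq.codeK.
exists A; split.
  by apply: recursive_ext (cA 1%N) _ => v; rewrite (tnth_nth 0%N).
move=> _ n <-; rewrite /A; have [f0|f0] := is_zeroP.
  (* Everything divides the zero polynomial, with cofactor 0. *)
  move=> v psi _ line_psi; split=> //; exists [fsfun]; apply/fsfunP => w.
  rewrite f0 fsfun0E laurent_mulE big1 // => u _.
  by rewrite fsfun0E mulr0.
rewrite /= CodeSeq.codeK.
have -> :
    [seq (vec_of_code e, laurent_of_code nu (entry e 2)) | e <- [seq item n i | i <- js n]]
    = [seq (vec_of_code i, laurent_of_code nu (phi n i)) | i <- js n].
  rewrite -map_comp; apply: eq_map => i /=.
  by rewrite /vec_of_code /entry /item !CodeSeq.codeK.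
have mem_js i : i \in js n = good n i && (i \in iota 0 (vec_bound (n + n))).
  by rewrite mem_filter mem_rev.
have cert i (pv : primitive (vec_of_code i)) := check_certificate pv (MP [:: n; i]).
split=> [v|v psi].
  rewrite -map_comp; split=> [/mapP[i]|[pv [psi psif]]].
    rewrite mem_js => /andP[/andP[pv two_phi] _] -> /=; split=> //.
    by apply/(certificate_line_factor pv (cert i pv) f0); rewrite -has_two_termsE.
  have [v1 v2] := line_factor_bound pv psif f0.
  have [i i_in iv] := vec_of_code_bound v1 v2; rewrite -iv in pv psif *.
  apply: (map_f (fun i => vec_of_code i)).
  rewrite mem_js i_in /good pv /= andbT has_two_termsE.
  by apply/(certificate_line_factor pv (cert i pv) f0); exists psi.
move=> /mapP[i]; rewrite mem_js => /andP[/andP[pv]].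
rewrite has_two_termsE => two_phi _ [-> ->]; split.
  exact: certificate_factor (cert i pv) two_phi.
by move=> psi'; exact: certificate_dvd (cert i pv).
Qed.
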